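(* For every $\psi\in AHHol_5^{LF}(\mathbb{C}P^3)$ there exist $g\in PSp(2)$, $\omega\in PSU(2)$ and $\eta\in[0,+\infty)$ such that $g\circ\psi\circ\omega=\Psi^5_\eta$, where $$\Psi_\eta^5(z)=[1+qz,\;-qz^4+z^5,\;\mu z+\eta z^2,\;\eta z^3-\mu z^4],$$ $$q=\frac{\eta}{\sqrt3}\sqrt{\frac{\eta^2+5}{\eta^2+4}},\qquad \mu=\frac{2}{\sqrt3}\sqrt{\frac{\eta^2+5}{\eta^2+4}}.$$
   Context: Identify $S^2=\mathbb{C}P^1=\mathbb{C}\cup\{\infty\}$ with coordinate $z$, so that the antipodal map is $z\mapsto-1/\bar z$. The twistor fibration $\pi:\mathbb{C}P^3\to S^4\subset\mathbb{C}^2\oplus\mathbb{R}=\mathbb{R}^5$ is $$\pi([z_1,z_2,z_3,z_4])=\frac{\left(2(\bar z_1z_3+z_2\bar z_4),\,2(\bar z_1z_4-z_2\bar z_3),\,|z_1|^2+|z_2|^2-|z_3|^2-|z_4|^2\right)}{|z_1|^2+|z_2|^2+|z_3|^2+|z_4|^2}.$$ A holomorphic curve $\psi=[f_1,f_2,f_3,f_4]:S^2\to\mathbb{C}P^3$ is horizontal if it is tangent to the orthogonal complement (for the Fubini-Study metric) of the fibers of $\pi$; equivalently $f_1'f_2-f_1f_2'+f_3'f_4-f_3f_4'=0$. It is linearly full if its image lies in no projective hyperplane. A holomorphic curve of degree $d$ is written $[f_1,f_2,f_3,f_4]$ with $f_i$ polynomials without common zeros and maximal degree $d$. $HHol_d^{LF}(\mathbb{C}P^3)$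 is the set of linearly full horizontal holomorphic curves $S^2\to\mathbb{C}P^3$ of degree $d$. $AHHol_d^{LF}(\mathbb{C}P^3)\subset HHol_d^{LF}(\mathbb{C}P^3)$ is the subset of those $\psi$ for which $\pi\circ\psi:S^2\to S^4$ is invariant under the antipodal map of $S^2$ (these are the twistor lifts of the linearly full harmonic maps $S^2\to S^4$ of degree $d$ that factor through $\mathbb{R}P^2$). Let $J$ be the $4\times4$ matrix that is block diagonal with two blocks $\begin{pmatrix}0&-1\\1&0\end{pmatrix}$, $Sp(2;\mathbb{C})=\{A\in SL(4;\mathbb{C}): A^tJA=J\}$, $Sp(2)=Sp(2;\mathbb{C})\cap U(4)$. $PSp(2)$ is its projectivization, acting on $\mathbb{C}P^3$ in the standard way and on curves by postcomposition. $PSU(2)\cong SO(3)$ acts on $S^2=\mathbb{C}P^1$ by rotations (Möbius transformations) and on curves by precomposition. *)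

(* Defs.v *)
From HB Require Import structures.
From mathcomp Require Import all_boot all_order all_algebra.
From mathcomp Require Import complex sesquilinear spectral.
From mathcomp Require Import all_classical all_reals all_analysis.

Set Implicit Arguments.
Unset Strict Implicit.
Unset Printing Implicit Defensive.

Import Order.TTheory GRing.Theory Num.Theory.
Import numFieldNormedType.Exports.

Local Open Scope ring_scope.

(* S^2 = C \cup {oo}; [None] is the point at infinity. *)
Definition sphere (R : realType) : Type := option R[i].

Definition antipodal (R : realType) (z : sphere R) : sphere R :=
  match z with
  | Some z => if z == 0 then None else Some (- (z^*)^-1)
  | None => Some 0
  end.

(* CP^n is the set of complex lines through the origin of C^(n+1). *)
Definition CP (R : realType) (n : nat) : Type :=
  {U : {vspace 'cV[R[i]]_n.+1} | \dim U == 1%N}.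

Lemma dim_line_e0 (R : realType) (n : nat) :
  \dim <[delta_mx ord0 ord0 : 'cV[R[i]]_n.+1]>%VS == 1%N.
Proof.
rewrite dim_vline; suff -> : delta_mx ord0 ord0 != 0 :> 'cV[R[i]]_n.+1 by [].
by apply/eqP => /matrixP /(_ ord0 ord0) /eqP; rewrite !mxE !eqxx oner_eq0.
Qed.

(* The point [v_0, ..., v_n], with junk value [1, 0, ..., 0] when v = 0. *)
Definition pt (R : realType) (n : nat) (v : 'cV[R[i]]_n.+1) : CP R n :=
  insubd (exist (fun U : {vspace 'cV[R[i]]_n.+1} => \dim U == 1%N)
            <[delta_mx ord0 ord0]>%VS (dim_line_e0 R n)) <[v]>%VS.

(* Some choice of homogeneous coordinates; every use below is through an
   expression that does not depend on the choice. *)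
Definition hcoord (R : realType) (n : nat) (p : CP R n) : 'cV[R[i]]_n.+1 :=
  vpick (val p).

Definition hdot (R : realType) (n : nat) (u v : 'cV[R[i]]_n) : R[i] :=
  \sum_i u i ord0 * (v i ord0)^*.

Definition nsq (R : realType) (z : R[i]) : R :=
  complex.Re z ^+ 2 + complex.Im z ^+ 2.

(* The twistor fibration in homogeneous coordinates, with
   C^2 (+) R identified with R^5 by (a, b, c) |-> (Re a, Im a, Re b, Im b, c). *)
Definition twistor_hom (R : realType) (v : 'cV[R[i]]_4) : 'rV[R]_5 :=
  let z1 := v (inord 0) ord0 in let z2 := v (inord 1) ord0 in
  let z3 := v (inord 2) ord0 in let z4 := v (inord 3) ord0 in
  let a := 2 * (z1^* * z3 + z2 * z4^*) in
  let b := 2 * (z1^* * z4 - z2 * z3^*) in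
  let c := nsq z1 + nsq z2 - nsq z3 - nsq z4 in
  (nsq z1 + nsq z2 + nsq z3 + nsq z4)^-1 *:
  \row_k nth 0 [:: complex.Re a; complex.Im a; complex.Re b; complex.Im b; c] k.

Definition twistor (R : realType) (p : CP R 3) : 'rV[R]_5 :=
  twistor_hom (hcoord p).

(* For v != 0, the tangent space of CP^3 at [v] is identified with the
   Hermitian complement of v, on which the Fubini-Study metric is
   Re <a, b> / <v, v> (up to a global constant factor). *)
Definition tangent_proj (R : realType) (n : nat) (v w : 'cV[R[i]]_n) :
    'cV[R[i]]_n :=
  w - (hdot w v / hdot v v) *: v.

Definition fubini_study (R : realType) (n : nat) (v a b : 'cV[R[i]]_n) : R :=
  complex.Re (hdot a b / hdot v v).

(* w is a tangent vector at [v] in the kernel of the differential of the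
   twistor fibration, that is, tangent to the fibre through [v]. *)
Definition vertical (R : realType) (v w : 'cV[R[i]]_4) : Prop :=
  hdot w v = 0 /\
  is_derive (0 : R) (1 : R) (fun t : R => twistor_hom (v + t%:C%C *: w)) 0.

Definition eval_at (R : realType) (n : nat) (f : 'cV[{poly R[i]}]_n) (z : R[i]) :
    'cV[R[i]]_n :=
  map_mx (fun p : {poly R[i]} => p.[z]) f.

(* The lift in the chart w = 1/z of the curve [f] of degree d:
   w |-> w^d f(1/w). *)
Definition rev_lift (R : realType) (n d : nat) (f : 'cV[{poly R[i]}]_n) :
    'cV[{poly R[i]}]_n :=
  map_mx (fun p : {poly R[i]} => \poly_(i < d.+1) p`_(d - i)) f.

Definition poly_curve (R : realType) (n d : nat) (f : 'cV[{poly R[i]}]_n.+1)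
    (z : sphere R) : CP R n :=
  match z with
  | Some z => pt (eval_at f z)
  | None => pt (eval_at (rev_lift d f) 0)
  end.

(* psi = [f_0, ..., f_n] with the f_i polynomials without common zeros and of
   maximal degree d. *)
Definition represents (R : realType) (n d : nat) (f : 'cV[{poly R[i]}]_n.+1)
    (psi : sphere R -> CP R n) : Prop :=
  [/\ forall z : R[i], exists i, (f i ord0).[z] != 0,
      (\max_i size (f i ord0))%N = d.+1 &
      psi =1 poly_curve d f].

(* The differential of z |-> [f z] at z maps c to the tangent vector
   tangent_proj (f z) (c f'(z)); it must be orthogonal to the fibre. *)
Definition horizontal_at (R : realType) (f : 'cV[{poly R[i]}]_4) (z : R[i]) :
    Prop :=
  forall (c : R[i]) (w : 'cV[R[i]]_4),
    vertical (eval_at f z) w ->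
    fubini_study (eval_at f z)
      (tangent_proj (eval_at f z) (c *: eval_at (map_mx (@deriv _) f) z)) w = 0.

Definition HHol (R : realType) (d : nat) (psi : sphere R -> CP R 3) : Prop :=
  exists f : 'cV[{poly R[i]}]_4,
    [/\ represents d f psi,
        forall z : R[i], horizontal_at f z &
        horizontal_at (rev_lift d f) 0].

(* Projective hyperplanes of CP^n are the n-dimensional subspaces of C^(n+1). *)
Definition linearly_full (R : realType) (n : nat) (psi : sphere R -> CP R n) :
    Prop :=
  forall H : {vspace 'cV[R[i]]_n.+1}, \dim H = n ->
    ~ (forall z, (val (psi z) <= H)%VS).

Definition HHolLF (R : realType) (d : nat) (psi : sphere R -> CP R 3) : Prop :=
  HHol d psi /\ linearly_full psi.

Definition AHHolLF (R : realType) (d : nat) (psi : sphere R -> CP R 3) : Prop :=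
  HHolLF d psi /\
  forall z, twistor (psi (antipodal z)) = twistor (psi z).

Definition J2 (R : realType) : 'M[R[i]]_2 :=
  \matrix_(i, j) if (i < j)%N then -1 else if (j < i)%N then 1 else 0.

Definition J4 (R : realType) : 'M[R[i]]_4 := block_mx (J2 R) 0 0 (J2 R).

Definition Sp2C (R : realType) (A : 'M[R[i]]_4) : Prop :=
  \det A = 1 /\ A^T *m J4 R *m A = J4 R.

Definition Sp2 (R : realType) (A : 'M[R[i]]_4) : Prop :=
  Sp2C A /\ A \is unitarymx.

(* PSp(2) is taken as the group of transformations of CP^3 induced by Sp(2). *)
Definition PSp2 (R : realType) (g : CP R 3 -> CP R 3) : Prop :=
  exists2 A : 'M[R[i]]_4, Sp2 A & forall p, g p = pt (A *m hcoord p).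

Definition mobius (R : realType) (M : 'M[R[i]]_2) (z : sphere R) : sphere R :=
  let a := M ord0 ord0 in let b := M ord0 ord_max in
  let c := M ord_max ord0 in let d := M ord_max ord_max in
  match z with
  | Some z => if c * z + d == 0 then None else Some ((a * z + b) / (c * z + d))
  | None => if c == 0 then None else Some (a / c)
  end.

(* PSU(2) is taken as the group of Moebius transformations induced by SU(2). *)
Definition PSU2 (R : realType) (omega : sphere R -> sphere R) : Prop :=
  exists2 M : 'M[R[i]]_2,
    \det M = 1 /\ M \is unitarymx & forall z, omega z = mobius M z.

Definition qcoef (R : realType) (eta : R) : R :=
  eta / Num.sqrt 3 * Num.sqrt ((eta ^+ 2 + 5) / (eta ^+ 2 + 4)).

Definition mucoef (R : realType) (eta : R) : R :=
  2 / Num.sqrt 3 * Num.sqrt ((eta ^+ 2 + 5) / (eta ^+ 2 + 4)).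

Definition Psi5 (R : realType) (eta : R) : sphere R -> CP R 3 :=
  let q : {poly R[i]} := ((qcoef eta)%:C%C)%:P in
  let mu : {poly R[i]} := ((mucoef eta)%:C%C)%:P in
  let h : {poly R[i]} := (eta%:C%C)%:P in
  poly_curve 5
    (\col_i nth 0 [:: 1 + q * 'X;
                      - q * 'X^4 + 'X^5;
                      mu * 'X + h * 'X^2;
                      h * 'X^3 - mu * 'X^4] i).

(* Main.v *)
Require Import Defs.
From mathcomp Require Import all_boot all_order all_algebra.
From mathcomp Require Import all_reals.
From mathcomp Require Import boolp functions derive.
From mathcomp Require Import complex sesquilinear spectral ring.

Set Implicit Arguments.
Unset Strict Implicit.
Unset Printing Implicit Defensive.

Import Order.TTheory GRing.Theory Num.Theory.

Local Open Scope ring_scope.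

(** Let j(v) = J conj(v) be the quaternionic structure of C^4 ([qj]). The fibre
    of the twistor fibration through [v] is the projective line spanned by v and
    j(v). So if f is a lift of psi, antipodal invariance says that f(z), j f(z)
    and j f(-1/conj z) are dependent for every z. Their 3x3 minors are
    polynomials in z and conj z, linear in j f(z); the variables z and conj z
    can be separated ([polarization]), and since psi is linearly full, the
    factor j f(z) can then be cancelled. Hence f(z) is parallel to the
    polynomial curve z^5 j f(-1/conj z), and after multiplying f by a constant
    the two are equal ([antipodal_qreal]): the coefficients A_k of f satisfy
    A_(5-k) = (-1)^k j(A_k), so f is determined by A_0, A_1, A_2.

    Let omega be the symplectic form ([sympl]), so that omega(u, j v) = <u, v>.
    The vector j(v) is tangent to the fibre at [v], so horizontality becomes
    omega(f, f') = 0, and with the symmetry of f its coefficients read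
      omega(A_0, A_1) = omega(A_0, A_2) = 0,
      3 <A_0, A_2> + omega(A_1, A_2) = 0,
      2 <A_0, A_1> = <A_1, A_2>,
      3 |A_1|^2 = 5 |A_0|^2 + |A_2|^2.

    The normal form has omega(A_1, A_2) = 0. In terms of f this number is the
    value at 0 of omega(f', f'')/2, which for a horizontal quintic is a section
    of O(4), that is, a polynomial of degree at most 4. It is covariant under
    Moebius transformations ([sympl_translate], [sympl_shear]), and its extreme
    coefficients are conjugate by the symmetry of f, so that it has a zero in C
    ([exists_flex]). Rotating S^2 moves this zero to 0, and rotating S^2 about
    the axis through 0 and infinity makes <A_1, A_2> nonnegative
    ([normal_rotation]).

    Now A_0 and A_2 are orthogonal over the quaternions, so an element of Sp(2)
    maps them to r e_1 and s e_3; it then maps A_1 to (m s / (2 r)) e_1 + m e_3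
    ([normal_frame]). The remaining relation determines m / r in terms of
    eta = s / r, which is the formula for mu in the statement
    ([normal_coefs]). The other three coefficients follow because Sp(2) commutes
    with j. *)

(** * Polynomials *)

Lemma poly_natr_eq0 (F : numDomainType) (p : {poly F}) :
  (forall n : nat, p.[n%:R] = 0) -> p = 0.
Proof.
move=> p0; pose s := [seq i%:R : F | i <- iota 0 (size p)].
apply: (@roots_geq_poly_eq0 _ p s).
- by apply/allP => _ /mapP[i _ ->]; apply/rootP.
- by rewrite map_inj_uniq ?iota_uniq //; apply: mulrIn; rewrite oner_eq0.
- by rewrite size_map size_iota.
Qed.

Lemma coefs_eq0 (F : numDomainType) (n : nat) (c : nat -> F) :
  (forall x, \sum_(0 <= k < n) c k * x ^+ k = 0) ->
  forall k, (k < n)%N -> c k = 0.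
Proof.
move=> c0 k lt_kn; have := coef_poly n c k; rewrite lt_kn => <-.
rewrite (_ : \poly_(i < n) c i = 0) ?coef0 //.
apply: poly_natr_eq0 => l; rewrite horner_poly.
by rewrite -(big_mkord xpredT (fun j => c j * l%:R ^+ j)) c0.
Qed.

(** The combinations of the f_i form an ideal, which contains their gcd; over an
    algebraically closed field a gcd without roots is a nonzero constant. *)
Lemma Bezout_closed (F : closedFieldType) n (f : 'cV[{poly F}]_n) :
  (forall z, exists i, (f i ord0).[z] != 0) ->
  exists u : 'I_n -> {poly F}, \sum_i u i * f i ord0 = 1.
Proof.
move=> nz; pose I p := exists u : 'I_n -> {poly F}, \sum_i u i * f i ord0 = p.
have IZ p q : I q -> I (p * q).
  move=> [u <-]; exists (fun i => p * u i); rewrite big_distrr /=.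
  by apply: eq_bigr => i _; rewrite mulrA.
have ID p q : I p -> I q -> I (p + q).
  move=> [u <-] [v <-]; exists (fun i => u i + v i); rewrite -big_split.
  by apply: eq_bigr => i _; rewrite mulrDl.
pose ps := [seq f i ord0 | i <- enum 'I_n].
have Igcd : I (\big[@gcdp F/0]_(p <- ps) p).
  rewrite big_map; apply: (big_ind I).
  - by exists (fun=> 0); apply: big1 => i _; rewrite mul0r.
  - move=> p q Ip Iq; have [[a b] /=] := Bezoutp p q.
    rewrite eqp_sym => /eqpf_eq[c _ ->].
    by rewrite -mul_polyC; apply/IZ/ID; apply: IZ.
  move=> i _; exists (fun j => (j == i)%:R).
  by rewrite (bigD1 i) //= eqxx mul1r big1 ?addr0 // => j /negPf->; rewrite mul0r.
have : size (\big[@gcdp F/0]_(p <- ps) p) == 1.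
  apply: contraT => /closed_rootP[z]; rewrite root_biggcd => /allP rz.
  have [i /negP[]] := nz z; apply/eqP/rootP/rz.
  by apply: (map_f (fun j => f j ord0)); rewrite mem_enum.
case/size_poly1P => c c0 gE.
by have := IZ (c^-1)%:P _ Igcd; rewrite gE -polyCM mulVf.
Qed.

(** * The Hermitian product *)

Section Hermitian.
Variables (R : realType) (n : nat).
Local Notation C := R[i].
Implicit Types u v : 'cV[C]_n.

Lemma hdotZl (c : C) u v : hdot (c *: u) v = c * hdot u v.
Proof. by rewrite mulr_sumr; apply: eq_bigr => i _; rewrite mxE mulrA. Qed.

Lemma hdotZr (c : C) u v : hdot u (c *: v) = c^* * hdot u v.
Proof.
by rewrite mulr_sumr; apply: eq_bigr => i _; rewrite mxE rmorphM mulrCA.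
Qed.

Lemma hdotC u v : (hdot u v)^* = hdot v u.
Proof.
by rewrite rmorph_sum; apply: eq_bigr => i _; rewrite rmorphM /= conjCK mulrC.
Qed.

Lemma hdot0r u : hdot u 0 = 0.
Proof. by apply: big1 => i _; rewrite mxE conjC0 mulr0. Qed.

Lemma hdot_ge0 u : 0 <= hdot u u.
Proof. by apply: sumr_ge0 => i _; rewrite -normCK exprn_ge0. Qed.

Lemma hdot_eq0 u : (hdot u u == 0) = (u == 0).
Proof.
apply/eqP/eqP => [/eqP|->]; last first.
  by apply: big1 => i _; rewrite mxE mul0r.
rewrite psumr_eq0 => [/allP u0|i _]; last by rewrite -normCK exprn_ge0.
apply/colP => i; rewrite mxE; apply/eqP; rewrite -normr_eq0 -sqrf_eq0 normCK.
exact: (u0 i (mem_index_enum i)).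
Qed.

Definition hnorm u : C := sqrtC (hdot u u).

Lemma hnorm_ge0 u : 0 <= hnorm u.
Proof. by rewrite sqrtC_ge0 hdot_ge0. Qed.

Lemma hnorm_eq0 u : (hnorm u == 0) = (u == 0).
Proof. by rewrite sqrtC_eq0 hdot_eq0. Qed.

Lemma conj_hnorm u : (hnorm u)^* = hnorm u.
Proof. by apply/CrealP; rewrite ger0_real ?hnorm_ge0. Qed.

Lemma hdot_normalized u : u != 0 ->
  hdot ((hnorm u)^-1 *: u) ((hnorm u)^-1 *: u) = 1.
Proof.
move=> u0; have n0 : hnorm u != 0 by rewrite hnorm_eq0.
rewrite hdotZl hdotZr fmorphV /= conj_hnorm -[hdot u u]sqrtCK -/(hnorm u).
by rewrite expr2 mulKf ?mulVf.
Qed.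

End Hermitian.

Lemma hdot_unitary (R : realType) n (g : 'M[R[i]]_n) x y : g \is unitarymx ->
  hdot (g *m x) (g *m y) = hdot x y.
Proof.
move=> gU.
have hdotmx a b : hdot a b = ((b ^t*)%sesqui *m a) ord0 ord0.
  by rewrite mxE; apply: eq_bigr => i _; rewrite !mxE mulrC.
rewrite !hdotmx trmx_mul map_mxM -mulmxA [X in (_ *m X) _ _]mulmxA.
by rewrite -invmx_unitary // mulVmx ?unitarymx_unit // mul1mx.
Qed.

Lemma conjmxK (R : realType) m n (M : 'M[R[i]]_(m, n)) : map_mx Num.conj (map_mx Num.conj M) = M.
Proof. by apply/matrixP => i j; rewrite !mxE conjCK. Qed.

(** * The quaternionic and the symplectic structure of C^4 *)

(** Indexing by [nat] instead of ['I_4] makes the coordinates of [vec4] compute,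
    so that identities between vectors of C^4 reduce to [ring]. *)
Definition entry (T : Type) (u : 'cV[T]_4) (k : nat) : T := u (inord k) ord0.

Definition vec4 (T : nmodType) (a b c d : T) : 'cV[T]_4 :=
  \col_i nth 0 [:: a; b; c; d] i.

Lemma entry_vec4 (T : nmodType) (a b c d : T) (k : nat) :
  (k < 4)%N -> entry (vec4 a b c d) k = nth 0 [:: a; b; c; d] k.
Proof. by move=> lt_k; rewrite /entry mxE inordK. Qed.

Lemma ord4P (P : 'I_4 -> Prop) :
  P (inord 0) -> P (inord 1) -> P (inord 2) -> P (inord 3) -> forall i, P i.
Proof.
move=> P0 P1 P2 P3 [[|[|[|[|//]]]] lti];
  [move: P0|move: P1|move: P2|move: P3]; congr P; apply: val_inj; exact: inordK.
Qed.

Lemma entry_inj (T : Type) (u v : 'cV[T]_4) :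
  (forall k, (k < 4)%N -> entry u k = entry v k) -> u = v.
Proof.
by move=> eq_uv; apply/colP; apply: ord4P; apply: eq_uv.
Qed.

Lemma sum4E (T : nmodType) (F : 'I_4 -> T) :
  \sum_i F i = F (inord 0) + F (inord 1) + F (inord 2) + F (inord 3).
Proof.
rewrite !big_ord_recl big_ord0 addr0 !addrA.
by congr (F _ + F _ + F _ + F _); apply: val_inj; rewrite /= inordK.
Qed.

Lemma sum6E (T : nmodType) (F : nat -> T) :
  \sum_(0 <= k < 6) F k = F 0%N + F 1%N + F 2%N + F 3%N + F 4%N + F 5%N.
Proof. by rewrite unlock /= addr0 !addrA. Qed.

Lemma entryD (T : nmodType) (u v : 'cV[T]_4) k : entry (u + v) k = entry u k + entry v k.
Proof. by rewrite /entry mxE. Qed.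
Lemma entry0 (T : nmodType) k : entry (0 : 'cV[T]_4) k = 0.
Proof. by rewrite /entry mxE. Qed.
Lemma entryN (T : zmodType) (u : 'cV[T]_4) k : entry (- u) k = - entry u k.
Proof. by rewrite /entry mxE. Qed.
Lemma entryZ (T : pzRingType) (c : T) (u : 'cV[T]_4) k : entry (c *: u) k = c * entry u k.
Proof. by rewrite /entry mxE. Qed.

Section Quaternionic.
Variable R : realType.
Local Notation C := R[i].
Implicit Types u v w : 'cV[C]_4.

(** Multiplication by the quaternion j, for the identification of C^4 with H^2
    in which (z1, z2) is the first quaternionic coordinate and (z3, z4) the
    second one. *)
Definition qj u : 'cV[C]_4 :=
  vec4 (- (entry u 1)^*) ((entry u 0)^*) (- (entry u 3)^*) ((entry u 2)^*).

(** The opposite of the form of matrix [J4]; with this sign [sympl_qj] holds.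
    [hdot] and [sympl] are the two complex components of the quaternionic
    Hermitian product. *)
Definition sympl u v : C :=
  entry u 0 * entry v 1 - entry u 1 * entry v 0 + entry u 2 * entry v 3 - entry u 3 * entry v 2.

Lemma hdotE u v : hdot u v = entry u 0 * (entry v 0)^* + entry u 1 * (entry v 1)^* +
  entry u 2 * (entry v 2)^* + entry u 3 * (entry v 3)^*.
Proof. by rewrite /hdot sum4E. Qed.

Lemma sympl_qj u v : sympl u (qj v) = hdot u v.
Proof. by rewrite /sympl hdotE !entry_vec4 //=; ring. Qed.

Lemma qjD u v : qj (u + v) = qj u + qj v.
Proof.
by apply: entry_inj => -[|[|[|[|//]]]] _; rewrite entryD !entry_vec4 //= !entryD; ring.
Qed.

Lemma qjZ (c : C) u : qj (c *: u) = c^* *: qj u.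
Proof.
by apply: entry_inj => -[|[|[|[|//]]]] _; rewrite entryZ !entry_vec4 //= !entryZ; ring.
Qed.

Lemma qjK u : qj (qj u) = - u.
Proof.
apply: entry_inj => -[|[|[|[|//]]]] _; rewrite entryN !entry_vec4 //= ?conjCK //;
  by rewrite rmorphN /= conjCK.
Qed.

Lemma hdot_qjr u v : hdot u (qj v) = - sympl u v.
Proof. by rewrite -sympl_qj qjK /sympl !entryN; ring. Qed.

Lemma hdot_qj2 u v : hdot (qj u) (qj v) = hdot v u.
Proof.
rewrite hdotE hdotE !entry_vec4 //= !rmorphN /= !conjCK; ring.
Qed.

Lemma symplDl u v w : sympl (u + v) w = sympl u w + sympl v w.
Proof. by rewrite /sympl !entryD; ring. Qed.

Lemma symplDr u v w : sympl w (u + v) = sympl w u + sympl w v.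
Proof. by rewrite /sympl !entryD; ring. Qed.

Lemma symplZl (c : C) u v : sympl (c *: u) v = c * sympl u v.
Proof. by rewrite /sympl !entryZ; ring. Qed.

Lemma symplZr (c : C) u v : sympl u (c *: v) = c * sympl u v.
Proof. by rewrite /sympl !entryZ; ring. Qed.

Lemma symplxx u : sympl u u = 0.
Proof. by rewrite /sympl; ring. Qed.

Lemma symplC u v : sympl v u = - sympl u v.
Proof. by rewrite /sympl; ring. Qed.

Lemma sympl_qj2 u v : sympl (qj u) (qj v) = (sympl u v)^*.
Proof. by rewrite /sympl !entry_vec4 //=; ring. Qed.

Lemma qj_hdotl u v : hdot (qj u) v = - (hdot u (qj v))^*.
Proof. by rewrite -sympl_qj sympl_qj2 hdot_qjr rmorphN /= opprK. Qed.

End Quaternionic.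

(** * Adapted frames in Sp(2) *)

(** Determinants of matrices given by functions on [nat], for which Laplace
    expansion never has to convert between ordinals of different bounds. *)
Definition ndet (F : comPzRingType) n (a : nat -> nat -> F) : F :=
  \det (\matrix_(i < n, j < n) a i j).

Lemma ndetS (F : comPzRingType) n (a : nat -> nat -> F) :
  ndet n.+1 a = \sum_(0 <= j < n.+1)
    a 0%N j * ((-1) ^+ j * ndet n (fun i k => a i.+1 (bump j k))).
Proof.
rewrite /ndet (expand_det_row _ ord0) big_mkord; apply: eq_bigr => j _.
rewrite mxE /cofactor add0n; congr (_ * (_ * \det _)).
by apply/matrixP => i k; rewrite !mxE.
Qed.

Section Frames.
Variable R : realType.
Local Notation C := R[i].
Implicit Types u v x : 'cV[C]_4.

(** When u and v are orthonormal over the quaternions, this is the inverse of the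
    matrix with columns u, j u, v, j v. *)
Definition frame_mx (u v : 'cV[C]_4) : 'M[C]_4 :=
  \matrix_(i, j) (nth 0 [:: u; qj u; v; qj v] i j ord0)^*.

Lemma mul_frame_mx u v x : frame_mx u v *m x =
  vec4 (hdot x u) (hdot x (qj u)) (hdot x v) (hdot x (qj v)).
Proof.
apply: entry_inj => i lt_i4; rewrite entry_vec4 // /entry mxE.
under eq_bigr => j _ do rewrite mxE inordK // mulrC.
by move: i lt_i4 => [|[|[|[|//]]]] _; rewrite /hdot.
Qed.

Lemma frame_mx_qj u v x : frame_mx u v *m qj x = qj (frame_mx u v *m x).
Proof.
rewrite !mul_frame_mx; apply: entry_inj => -[|[|[|[|//]]]] _; rewrite !entry_vec4 //=;
  by rewrite ?hdot_qj2 -?(hdotC x) // qj_hdotl.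
Qed.

(** The right side is the Pfaffian of the matrix of values of omega on u, j u, v,
    j v. The formula excludes the determinant -1, which taking determinants in
    A^T J A = J does not. *)
Lemma det_frame_mx u v : \det (frame_mx u v) =
  hdot u u * hdot v v - hdot u v * hdot v u - sympl u v * (sympl u v)^*.
Proof.
have -> : frame_mx u v = \matrix_(i < 4, j < 4) (entry (nth 0 [:: u; qj u; v; qj v] i) j)^*.
  by apply/matrixP => i j; rewrite !mxE /entry inord_val.
rewrite -/(ndet 4 (fun i j => (entry (nth 0 [:: u; qj u; v; qj v] i) j)^*)).
rewrite ndetS unlock /= !ndetS unlock /= !ndetS unlock /= !ndetS unlock /=.
rewrite /ndet !det_mx00 /bump /= !entry_vec4 //= !rmorphN /= !conjCK.
rewrite !hdotE /sympl !(rmorphB, rmorphD, rmorphM) /=.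
move: (entry u 0) (entry u 1) (entry u 2) (entry u 3) => a b c d.
move: (entry v 0) (entry v 1) (entry v 2) (entry v 3) => e f g h.
move: (a^*) (b^*) (c^*) (d^*) (e^*) (f^*) (g^*) (h^*).
move=> a' b' c' d' e' f' g' h'.
ring.
Qed.

Lemma J4E : J4 R = \matrix_(i, j) nth 0 (nth [::]
  [:: [:: 0; -1; 0; 0]; [:: 1; 0; 0; 0]; [:: 0; 0; 0; -1]; [:: 0; 0; 1; 0]] i) j.
Proof.
apply/matrixP => i j; rewrite !mxE.
case: (@splitP 2 2 i) => i' iE; rewrite !mxE; case: (@splitP 2 2 j) => j' jE; rewrite !mxE iE jE.
all: by move: i' j' {iE jE} => [[|[|//]] ?] [[|[|//]] ?].
Qed.

Lemma J4_mul x : J4 R *m x = qj (map_mx Num.conj x).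
Proof.
apply: entry_inj => i lt_i4; rewrite entry_vec4 // J4E /entry !mxE sum4E !mxE !inordK // !conjCK.
by move: i lt_i4 => [|[|[|[|//]]]] _ /=; ring.
Qed.

Lemma frame_mx_unitary u v : hdot u u = 1 -> hdot v v = 1 -> hdot u v = 0 ->
  sympl u v = 0 -> frame_mx u v \is unitarymx.
Proof.
move=> uu vv uv omuv.
have vu : hdot v u = 0 by rewrite -hdotC uv conjC0.
have omvu : sympl v u = 0 by rewrite symplC omuv oppr0.
apply/unitarymxP/matrixP => i k.
have -> : (frame_mx u v *m ((frame_mx u v) ^t*)%sesqui) i k =
    entry (frame_mx u v *m nth 0 [:: u; qj u; v; qj v] k) i.
  by rewrite /entry inord_val !mxE; apply: eq_bigr => j _; rewrite !mxE conjCK.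
rewrite mul_frame_mx entry_vec4 ?ltn_ord // mxE.
move: i k; do 2! (apply: ord4P); rewrite ?inordK //= -val_eqE /= !inordK //=.
all: rewrite ?hdot_qj2 ?qj_hdotl ?hdot_qjr ?symplxx ?uu ?vv ?uv ?vu ?omuv ?omvu.
all: by rewrite ?(oppr0, conjC0).
Qed.

Lemma map_J4 : map_mx Num.conj (J4 R) = J4 R.
Proof.
rewrite J4E; apply/matrixP => i j; rewrite !mxE.
by move: i j; do 2! (apply: ord4P); rewrite !inordK //= ?rmorphN /= ?conjC0 ?conjC1.
Qed.

(** A unitary matrix is symplectic as soon as it commutes with j: from
    g J = J conj(g), one gets g^T J g = (g^T conj(g)) J = J. *)
Lemma frame_mx_Sp2 u v : hdot u u = 1 -> hdot v v = 1 -> hdot u v = 0 ->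
  sympl u v = 0 -> Sp2 (frame_mx u v).
Proof.
move=> uu vv uv omuv; have gU := frame_mx_unitary uu vv uv omuv.
split=> //; split.
  by rewrite det_frame_mx uu vv uv omuv; ring.
move: gU (frame_mx_qj u v); move: (frame_mx u v) => g gU g_qj.
have gJ : g *m J4 R = J4 R *m map_mx Num.conj g.
  apply/matrixP => i k.
  have colE (M : 'M[C]_4) : M i k = (M *m delta_mx k ord0 : 'cV_4) i ord0.
    by rewrite -colE mxE.
  by rewrite [LHS]colE [RHS]colE -!mulmxA !J4_mul g_qj map_mxM conjmxK.
have Jg : J4 R *m g = map_mx Num.conj g *m J4 R.
  by have := congr1 (map_mx Num.conj) gJ; rewrite !map_mxM map_J4 conjmxK => <-.
rewrite -mulmxA Jg mulmxA.
have : map_mx Num.conj ((g ^t*)%sesqui *m g) = 1%:M.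
  by rewrite -invmx_unitary // mulVmx ?unitarymx_unit // map_mx1.
by rewrite map_mxM conjmxK => ->; rewrite mul1mx.
Qed.

End Frames.

(** * Quintic curves and linear substitutions *)

Section Quintics.
Variable R : realType.
Local Notation C := R[i].
Implicit Types A B : nat -> 'cV[C]_4.

(** Quintic curves are used in homogeneous form, A_0 y^5 + A_1 x y^4 + ... +
    A_5 x^5, on which rotations of S^2 act by linear substitutions, without
    exception at infinity; z = x / y. [quinticx] and [quinticy] are the partial
    derivatives. *)
Definition quintic A (x y : C) : 'cV[C]_4 :=
  \sum_(0 <= k < 6) (x ^+ k * y ^+ (5 - k)) *: A k.
Definition quinticx A (x y : C) : 'cV[C]_4 :=
  \sum_(0 <= k < 6) (k%:R * x ^+ k.-1 * y ^+ (5 - k)) *: A k.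
Definition quinticy A (x y : C) : 'cV[C]_4 :=
  \sum_(0 <= k < 6) ((5 - k)%:R * x ^+ k * y ^+ (5 - k).-1) *: A k.

Lemma entry_quintic A x y i : entry (quintic A x y) i =
  entry (A 0%N) i * y ^+ 5 + entry (A 1%N) i * x * y ^+ 4 + entry (A 2%N) i * x ^+ 2 * y ^+ 3
  + entry (A 3%N) i * x ^+ 3 * y ^+ 2 + entry (A 4%N) i * x ^+ 4 * y + entry (A 5%N) i * x ^+ 5.
Proof. by rewrite /quintic sum6E !entryD !entryZ /= !subSS ?subn0; ring. Qed.

Lemma entry_quinticx A x y i : entry (quinticx A x y) i =
  entry (A 1%N) i * y ^+ 4 + 2 * entry (A 2%N) i * x * y ^+ 3
  + 3 * entry (A 3%N) i * x ^+ 2 * y ^+ 2 + 4 * entry (A 4%N) i * x ^+ 3 * y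
  + 5 * entry (A 5%N) i * x ^+ 4.
Proof. by rewrite /quinticx sum6E !entryD !entryZ /= !subSS ?subn0; ring. Qed.

Lemma entry_quinticy A x y i : entry (quinticy A x y) i =
  5 * entry (A 0%N) i * y ^+ 4 + 4 * entry (A 1%N) i * x * y ^+ 3
  + 3 * entry (A 2%N) i * x ^+ 2 * y ^+ 2 + 2 * entry (A 3%N) i * x ^+ 3 * y + entry (A 4%N) i * x ^+ 4.
Proof. by rewrite /quinticy sum6E !entryD !entryZ /= !subSS ?subn0; ring. Qed.

(** The coefficient of x^m y^(5-m) in (a x + b y)^k (c x + d y)^(5-k). *)
Definition subst_coef (a b c d : C) (k m : nat) : C :=
  \sum_(0 <= i < m.+1) ('C(k, i) * 'C(5 - k, m - i))%:R *
     (a ^+ i * b ^+ (k - i) * c ^+ (m - i) * d ^+ (5 - k - (m - i))).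

Definition subst (a b c d : C) A (m : nat) : 'cV[C]_4 :=
  \sum_(0 <= k < 6) subst_coef a b c d k m *: A k.

Lemma sum_subst a b c d A (e : nat -> C) :
  \sum_(0 <= m < 6) e m *: subst a b c d A m =
  \sum_(0 <= k < 6) (\sum_(0 <= m < 6) e m * subst_coef a b c d k m) *: A k.
Proof.
under eq_bigr => m _ do rewrite /subst scaler_sumr.
rewrite exchange_big; apply: eq_bigr => k _ /=.
by rewrite scaler_suml; apply: eq_bigr => m _; rewrite scalerA.
Qed.

Ltac subst_coef_ring :=
  rewrite sum6E /subst_coef;
  match goal with k : nat |- _ => case: k => [|[|[|[|[|[|//]]]]]] _ end;
  rewrite unlock /= !subSS ?subn0 !binE /=; ring.

(** This identity and the next two are the generating function of the numbers
    [subst_coef] and its partial derivatives: they give the value and, by the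
    chain rule, the derivatives of a substituted curve. *)
Lemma subst_coef_sum a b c d (k : nat) x y : (k < 6)%N ->
  \sum_(0 <= m < 6) (x ^+ m * y ^+ (5 - m)) * subst_coef a b c d k m =
  (a * x + b * y) ^+ k * (c * x + d * y) ^+ (5 - k).
Proof. subst_coef_ring. Qed.

Lemma subst_coef_sumx a b c d (k : nat) x y : (k < 6)%N ->
  \sum_(0 <= m < 6) (m%:R * x ^+ m.-1 * y ^+ (5 - m)) * subst_coef a b c d k m =
  a * (k%:R * (a * x + b * y) ^+ k.-1 * (c * x + d * y) ^+ (5 - k)) +
  c * ((5 - k)%:R * (a * x + b * y) ^+ k * (c * x + d * y) ^+ (5 - k).-1).
Proof. subst_coef_ring. Qed.

Lemma subst_coef_sumy a b c d (k : nat) x y : (k < 6)%N ->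
  \sum_(0 <= m < 6) ((5 - m)%:R * x ^+ m * y ^+ (5 - m).-1) * subst_coef a b c d k m =
  b * (k%:R * (a * x + b * y) ^+ k.-1 * (c * x + d * y) ^+ (5 - k)) +
  d * ((5 - k)%:R * (a * x + b * y) ^+ k * (c * x + d * y) ^+ (5 - k).-1).
Proof. subst_coef_ring. Qed.

Lemma quintic_subst a b c d A x y :
  quintic (subst a b c d A) x y = quintic A (a * x + b * y) (c * x + d * y).
Proof.
rewrite /quintic sum_subst; apply: eq_big_nat => k /andP[_ lt_k6].
by rewrite subst_coef_sum.
Qed.

Lemma quinticx_subst a b c d A x y (X := a * x + b * y) (Y := c * x + d * y) :
  quinticx (subst a b c d A) x y = a *: quinticx A X Y + c *: quinticy A X Y.
Proof.
rewrite /quinticx /quinticy sum_subst !scaler_sumr -big_split /=.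
apply: eq_big_nat => k /andP[_ lt_k6].
by rewrite subst_coef_sumx // !scalerA -scalerDl.
Qed.

Lemma quinticy_subst a b c d A x y (X := a * x + b * y) (Y := c * x + d * y) :
  quinticy (subst a b c d A) x y = b *: quinticx A X Y + d *: quinticy A X Y.
Proof.
rewrite /quinticx /quinticy sum_subst !scaler_sumr -big_split /=.
apply: eq_big_nat => k /andP[_ lt_k6].
by rewrite subst_coef_sumy // !scalerA -scalerDl.
Qed.

(** Euler's relation x F_x + y F_y = 5 F makes this equivalent to the affine
    condition omega(f, f') = 0 ([horizontalP]); this form is visibly invariant
    under linear substitutions. *)
Definition horizontal A :=
  forall x y, sympl (quinticx A x y) (quinticy A x y) = 0.

Lemma horizontal_subst a b c d A : horizontal A -> horizontal (subst a b c d A).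
Proof.
move=> hA x y; rewrite quinticx_subst quinticy_subst.
have := hA (a * x + b * y) (c * x + d * y).
move: (quinticx _ _ _) (quinticy _ _ _) => u v om0.
by rewrite !(symplDl, symplDr, symplZl, symplZr) !symplxx (symplC u v) om0; ring.
Qed.

(** The coefficients of omega(f, f') as a polynomial of degree 8: the one of
    x^n is the sum of (l - k) omega(A_k, A_l) over k < l, k + l = n + 1. *)
Definition contact_coefs A : seq C :=
  [:: sympl (A 0%N) (A 1%N);
      2 * sympl (A 0%N) (A 2%N);
      3 * sympl (A 0%N) (A 3%N) + sympl (A 1%N) (A 2%N);
      4 * sympl (A 0%N) (A 4%N) + 2 * sympl (A 1%N) (A 3%N);
      5 * sympl (A 0%N) (A 5%N) + 3 * sympl (A 1%N) (A 4%N) + sympl (A 2%N) (A 3%N);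
      4 * sympl (A 1%N) (A 5%N) + 2 * sympl (A 2%N) (A 4%N);
      3 * sympl (A 2%N) (A 5%N) + sympl (A 3%N) (A 4%N);
      2 * sympl (A 3%N) (A 5%N);
      sympl (A 4%N) (A 5%N)].

Lemma sympl_quinticxy A x y : sympl (quinticx A x y) (quinticy A x y) =
  - 5 * \sum_(0 <= k < 9) (contact_coefs A)`_k * x ^+ k * y ^+ (8 - k).
Proof.
rewrite unlock /= !subSS ?subn0 /sympl !entry_quinticx !entry_quinticy.
ring.
Qed.

Lemma sympl_quintic_quinticx A x : sympl (quintic A x 1) (quinticx A x 1) =
  \sum_(0 <= k < 9) (contact_coefs A)`_k * x ^+ k.
Proof. by rewrite unlock /= /sympl !entry_quintic !entry_quinticx; ring. Qed.

Lemma contact_coefs_eq0 A : (forall x, sympl (quintic A x 1) (quinticx A x 1) = 0) ->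
  forall k, (k < 9)%N -> (contact_coefs A)`_k = 0.
Proof.
move=> hA; apply: coefs_eq0 => x.
by rewrite -sympl_quintic_quinticx.
Qed.

Lemma horizontalP A :
  (forall x, sympl (quintic A x 1) (quinticx A x 1) = 0) <-> horizontal A.
Proof.
split=> hA x => [y|].
  rewrite sympl_quinticxy big_nat_cond big1 ?mulr0 // => k /andP[/andP[_ lt_k9] _].
  by rewrite contact_coefs_eq0 // !mul0r.
have /eqP := hA x 1; rewrite sympl_quinticxy mulf_eq0 oppr_eq0 pnatr_eq0 /= => /eqP <-.
by rewrite sympl_quintic_quinticx; apply: eq_bigr => k _; rewrite expr1n mulr1.
Qed.

(** The condition that f is fixed by the antilinear involution that maps f to
    z^5 j f(-1 / conj z), written on coefficients; [qrealP] is its homogeneous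
    form. *)
Definition qreal A := forall k, (k < 6)%N -> A (5 - k)%N = (-1) ^+ k *: qj (A k).

(** It lets coefficients be compared through values, which is how compositions
    of substitutions are handled. *)
Lemma quintic_inj A B :
  (forall x, quintic A x 1 = quintic B x 1) -> forall k, (k < 6)%N -> A k = B k.
Proof.
move=> eqAB k lt_k6; apply: entry_inj => i _; apply/eqP; rewrite -subr_eq0; apply/eqP.
apply: (coefs_eq0 (n := 6) (c := fun k => entry (A k) i - entry (B k) i)) => // x.
have /(congr1 (fun v : 'cV_4 => entry v i))/eqP := eqAB x.
rewrite -subr_eq0 !entry_quintic => /eqP eq0.
by rewrite sum6E -[RHS]eq0; ring.
Qed.

Lemma qj_quintic A x y :
  qj (quintic A x y) = quintic (fun k => qj (A k)) (x^*) (y^*).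
Proof.
rewrite /quintic sum6E !qjD !qjZ [RHS]sum6E.
by rewrite !(rmorphM, rmorphXn).
Qed.

Lemma quintic_rev A x y :
  - quintic A (- y) x = quintic (fun k => (-1) ^+ k *: A (5 - k)%N) x y.
Proof.
apply: entry_inj => i _; rewrite entryN !entry_quintic !entryZ !subSS !subn0; ring.
Qed.

Lemma qrealP A : qreal A <->
  forall x y, qj (quintic A x y) = - quintic A (- y^*) (x^*).
Proof.
split=> [rA x y | rA k lt_k6].
  rewrite qj_quintic quintic_rev; apply: eq_big_nat => k /andP[_ lt_k6].
  by rewrite rA // scalerA -exprMn mulrNN mulr1 expr1n scale1r.
have -> : qj (A k) = (-1) ^+ k *: A (5 - k)%N.
  apply: (quintic_inj (A := fun k => qj (A k)) (B := fun k => (-1) ^+ k *: A (5 - k)%N)) lt_k6 => x.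
  by rewrite -quintic_rev -[x]conjCK -(conjC1 C) -qj_quintic rA conjC1.
by rewrite scalerA -exprMn mulrNN mulr1 expr1n scale1r.
Qed.

(** Matrices of this shape are the multiples of elements of SU(2), and they
    commute with the antipodal map (x, y) |-> (- conj y, conj x). *)
Lemma qreal_subst a b A : qreal A -> qreal (subst a b (- b^*) (a^*) A).
Proof.
move/qrealP => rA; apply/qrealP => x y; rewrite !quintic_subst rA.
rewrite !(rmorphD, rmorphM, rmorphN) /= !conjCK.
by congr (- quintic A _ _); ring.
Qed.

Lemma quintic01 A : quintic A 0 1 = A 0%N.
Proof. by apply: entry_inj => i _; rewrite entry_quintic; ring. Qed.

Lemma quintic10 A : quintic A 1 0 = A 5%N.
Proof. by apply: entry_inj => i _; rewrite entry_quintic; ring. Qed.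

(** B is the Taylor expansion of f at z, so the left side is omega(f', f'')/2 at
    z. It has degree 6 a priori; horizontality removes the terms in z^5 and z^6
    and reduces the coefficient of z^4, 15 omega(A_2, A_5) +
    6 omega(A_3, A_4), to omega(A_3, A_4). *)
Lemma sympl_translate A z (B := subst 1 z 0 1 A) : horizontal A ->
  sympl (B 1%N) (B 2%N) =
  sympl (A 1%N) (A 2%N) + 3 * sympl (A 1%N) (A 3%N) * z +
  (6 * sympl (A 1%N) (A 4%N) + 3 * sympl (A 2%N) (A 3%N)) * z ^+ 2 +
  (10 * sympl (A 1%N) (A 5%N) + 8 * sympl (A 2%N) (A 4%N)) * z ^+ 3 +
  sympl (A 3%N) (A 4%N) * z ^+ 4.
Proof.
move/horizontalP/contact_coefs_eq0 => hA.
have /eqP := hA 6%N isT; rewrite /= addr_eq0 => /eqP o25.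
have /eqP := hA 7%N isT; rewrite /= mulf_eq0 pnatr_eq0 /= => /eqP o35.
have /= o45 := hA 8%N isT.
have B1 : B 1%N = A 1%N + (2 * z) *: A 2%N + (3 * z ^+ 2) *: A 3%N +
    (4 * z ^+ 3) *: A 4%N + (5 * z ^+ 4) *: A 5%N.
  rewrite /B /subst sum6E /subst_coef unlock /= !subSS ?subn0 !binE /=.
  by apply: entry_inj => i _; rewrite !entryD !entryZ; ring.
have B2 : B 2%N = A 2%N + (3 * z) *: A 3%N + (6 * z ^+ 2) *: A 4%N +
    (10 * z ^+ 3) *: A 5%N.
  rewrite /B /subst sum6E /subst_coef unlock /= !subSS ?subn0 !binE /=.
  by apply: entry_inj => i _; rewrite !entryD !entryZ; ring.
rewrite B1 B2 !(symplDl, symplDr, symplZl, symplZr) !symplxx.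
rewrite (symplC (A 2%N) (A 3%N)) (symplC (A 2%N) (A 4%N)) (symplC (A 2%N) (A 5%N)).
rewrite (symplC (A 3%N) (A 4%N)) (symplC (A 3%N) (A 5%N)) (symplC (A 4%N) (A 5%N)) o35 o45.
have -> : sympl (A 3%N) (A 4%N) = - 3 * sympl (A 2%N) (A 5%N) by rewrite mulNr o25 opprK.
ring.
Qed.

(** These substitutions fix the point x = 0. A rotation that sends 0 to a finite
    point z is the product of the translation by z and of such a substitution,
    so the vanishing of omega(f', f'') at z is preserved when z is rotated to
    0. *)
Lemma sympl_shear A d w (B := subst d 0 w 1 A) : horizontal A ->
  sympl (B 1%N) (B 2%N) = d ^+ 3 * sympl (A 1%N) (A 2%N).
Proof.
move/horizontalP/contact_coefs_eq0 => hA.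
have /= o01 := hA 0%N isT.
have /eqP := hA 1%N isT; rewrite /= mulf_eq0 pnatr_eq0 /= => /eqP o02.
have B1 : B 1%N = d *: A 1%N + (5 * w) *: A 0%N.
  rewrite /B /subst sum6E /subst_coef unlock /= !subSS ?subn0 !binE /=.
  by apply: entry_inj => i _; rewrite !entryD !entryZ; ring.
have B2 : B 2%N = d ^+ 2 *: A 2%N + (4 * w * d) *: A 1%N + (10 * w ^+ 2) *: A 0%N.
  rewrite /B /subst sum6E /subst_coef unlock /= !subSS ?subn0 !binE /=.
  by apply: entry_inj => i _; rewrite !entryD !entryZ; ring.
rewrite B1 B2 !(symplDl, symplDr, symplZl, symplZr) !symplxx.
by rewrite (symplC (A 0%N) (A 1%N)) o01 o02; ring.
Qed.

End Quintics.

(** * Coefficients of symmetric horizontal quintics *)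

Section NormalForm.
Variable R : realType.
Local Notation C := R[i].
Implicit Types A B : nat -> 'cV[C]_4.

(** These are the first five of the [contact_coefs], in which A_3, A_4, A_5 are
    replaced by j A_2, - j A_1, j A_0; by the symmetry, the others are the
    conjugates of these up to sign. *)
Lemma horizontal_relations (A : nat -> 'cV[C]_4) : qreal A -> horizontal A ->
  sympl (A 1%N) (A 2%N) = 0 ->
  [/\ sympl (A 0%N) (A 1%N) = 0, sympl (A 0%N) (A 2%N) = 0, hdot (A 0%N) (A 2%N) = 0,
      2 * hdot (A 0%N) (A 1%N) = hdot (A 1%N) (A 2%N) &
      3 * hdot (A 1%N) (A 1%N) = 5 * hdot (A 0%N) (A 0%N) + hdot (A 2%N) (A 2%N)].
Proof.
move=> rA /horizontalP/contact_coefs_eq0 hA o12.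
have A5 : A 5%N = qj (A 0%N) by rewrite (rA 0%N isT) scale1r.
have A4 : A 4%N = (-1) *: qj (A 1%N) by rewrite (rA 1%N isT).
have A3 : A 3%N = qj (A 2%N) by rewrite (rA 2%N isT) sqrrN expr1n scale1r.
have := hA 4%N isT; have := hA 3%N isT; have := hA 2%N isT; have := hA 1%N isT.
have /= := hA 0%N isT.
rewrite /= A5 A4 A3 !symplZr !sympl_qj o12 addr0 => o01.
move=> /eqP; rewrite mulf_eq0 pnatr_eq0 /= => /eqP o02.
move=> /eqP; rewrite mulf_eq0 pnatr_eq0 /= => /eqP h02 h01 n1.
split=> //.
  apply: (@mulfI _ 2); first by rewrite pnatr_eq0.
  by rewrite -[LHS]addr0 -[X in _ + X]h01; ring.
by rewrite -[LHS]addr0 -[X in _ + X]n1; ring.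
Qed.

(** The coefficients of degree 0 and 4 are conjugate. If they vanish, 0 is a
    root, and otherwise the polynomial has degree 4: in both cases it is not a
    nonzero constant. *)
Lemma exists_flex A : qreal A -> horizontal A ->
  exists z, let B := subst 1 z 0 1 A in sympl (B 1%N) (B 2%N) = 0.
Proof.
move=> rA hA.
pose p : {poly C} := Poly [:: sympl (A 1%N) (A 2%N); 3 * sympl (A 1%N) (A 3%N);
  6 * sympl (A 1%N) (A 4%N) + 3 * sympl (A 2%N) (A 3%N);
  10 * sympl (A 1%N) (A 5%N) + 8 * sympl (A 2%N) (A 4%N); sympl (A 3%N) (A 4%N)].
have pE z : p.[z] = sympl (subst 1 z 0 1 A 1%N) (subst 1 z 0 1 A 2%N).
  by rewrite horner_Poly /= sympl_translate //; ring.
suff /closed_rootP[z /rootP p0] : size p != 1%N by exists z; move=> B; rewrite -pE.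
apply/eqP => size_p1.
have p4 : p`_4 = 0 by apply: nth_default; rewrite size_p1.
have p0 : p`_0 = (p`_4)^*.
  rewrite !coef_Poly /= (rA 2 isT) (rA 1 isT) expr1 sqrrN expr1n !scale1r scaleN1r.
  by rewrite -scaleN1r symplZr sympl_qj2 mulN1r rmorphN /= conjCK -symplC.
have := size_p1; rewrite (size1_polyC (eq_leq size_p1)) p0 p4 conjC0.
by rewrite size_polyC eqxx.
Qed.

Lemma subst_phase A (t : C) (B := subst t 0 0 (t^*) A) : t * t^* = 1 ->
  [/\ sympl (B 1%N) (B 2%N) = t^* ^+ 4 * sympl (A 1%N) (A 2%N) &
      hdot (B 1%N) (B 2%N) = t^* ^+ 2 * hdot (A 1%N) (A 2%N)].
Proof.
move=> t1.
have B1 : B 1%N = (t * t^* ^+ 4) *: A 1%N.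
  rewrite /B /subst sum6E /subst_coef unlock /= !subSS ?subn0 !binE /=.
  by apply: entry_inj => i _; rewrite !entryD !entryZ; ring.
have B2 : B 2%N = (t ^+ 2 * t^* ^+ 3) *: A 2%N.
  rewrite /B /subst sum6E /subst_coef unlock /= !subSS ?subn0 !binE /=.
  by apply: entry_inj => i _; rewrite !entryD !entryZ; ring.
rewrite B1 B2; split.
  transitivity ((t * t^*) ^+ 3 * t^* ^+ 4 * sympl (A 1%N) (A 2%N)); last first.
    by rewrite t1 expr1n mul1r.
  by rewrite symplZl symplZr; ring.
transitivity ((t * t^*) ^+ 4 * t^* ^+ 2 * hdot (A 1%N) (A 2%N)); last first.
  by rewrite t1 expr1n mul1r.
by rewrite -sympl_qj qjZ symplZl symplZr sympl_qj !(rmorphM, rmorphXn) /= conjCK; ring.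
Qed.

(** The square is the one of [subst_phase]: a rotation about the axis through 0
    and infinity multiplies <A_1, A_2> by the square of a phase. *)
Lemma exists_phase (h : C) : exists2 t : C, t * t^* = 1 & 0 <= t^* ^+ 2 * h.
Proof.
have [-> | h_neq0] := eqVneq h 0.
  by exists 1; rewrite ?conjC1 ?mulr1 // mulr0.
have nh_neq0 : `|h| != 0 by rewrite normr_eq0.
pose t := sqrtC (h / `|h|).
have t2 : t ^+ 2 = h / `|h| by rewrite sqrtCK.
have nt : `|t| = 1.
  apply/eqP; rewrite -(@eqrXn2 _ 2) // -normrX t2 normf_div normr_id divff //.
  by rewrite expr1n.
exists t; first by rewrite -normCK nt expr1n.
rewrite -rmorphXn /= t2 rmorphM /= fmorphV /= conj_normC mulrAC [_ * h]mulrC -normCK.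
by rewrite expr2 mulfK.
Qed.

(** The rotation is the product of the one that sends 0 to the zero z found in
    [exists_flex] and of a rotation that fixes 0. *)
Lemma normal_rotation A : qreal A -> horizontal A ->
  exists a b B, [/\ a != 0,
    (forall x y, quintic B x y = quintic A (a * x + b * y) (- b^* * x + a^* * y)),
    qreal B, horizontal B &
    sympl (B 1%N) (B 2%N) = 0 /\ 0 <= hdot (B 1%N) (B 2%N)].
Proof.
move=> rA hA; have [z om0] := exists_flex rA hA.
pose A' := subst 1 z (- z^*) (1^*) A.
have om0' : sympl (A' 1%N) (A' 2%N) = 0.
  (* (1, z; -conj z, 1) = (1, z; 0, 1) (d, 0; -conj z, 1). *)
  pose d := 1 + z * z^*.
  have A'E k : (k < 6)%N -> A' k = subst d 0 (- z^*) 1 (subst 1 z 0 1 A) k.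
    apply: (quintic_inj (A := A')) => x.
    rewrite /A' conjC1 quintic_subst [RHS]quintic_subst [RHS]quintic_subst.
    by congr (quintic A _ _); rewrite /d; ring.
  rewrite !A'E // sympl_shear; last exact: horizontal_subst.
  by rewrite om0 mulr0.
have [t t1 hdot_ge0] := exists_phase (hdot (A' 1%N) (A' 2%N)).
exists t, (z * t^*), (subst t 0 (- 0^*) (t^*) A'); split.
- by apply/eqP => t0; move/eqP: t1; rewrite t0 mul0r eq_sym oner_eq0.
- move=> x y; rewrite !quintic_subst conjC0 conjC1 rmorphM /= conjCK.
  by congr (quintic A _ _); ring.
- by do 2 apply: qreal_subst.
- by do 2 apply: horizontal_subst.
rewrite conjC0 oppr0; have [-> ->] := subst_phase A' t1.
by rewrite om0' mulr0.
Qed.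

(** The second vector of the quaternionic frame is the direction of A_2. When
    A_2 vanishes, the relations force A_1 to be orthogonal to A_0 over the
    quaternions and to be nonzero, and its direction serves instead. *)
Lemma adapted_direction (A0 A1 A2 : 'cV[C]_4) :
  A0 != 0 -> sympl A0 A1 = 0 -> sympl A0 A2 = 0 -> hdot A0 A2 = 0 -> sympl A1 A2 = 0 ->
  2 * hdot A0 A1 = hdot A1 A2 ->
  3 * hdot A1 A1 = 5 * hdot A0 A0 + hdot A2 A2 -> 0 <= hdot A1 A2 ->
  exists v, [/\ hdot v v = 1, hdot A0 v = 0, sympl A0 v = 0 & 
    [/\ sympl A1 v = 0, 0 <= hdot A1 v & A2 = hnorm A2 *: v]].
Proof.
move=> A00 o01 o02 h02 o12 h01 nA1 h12.
have [A20 | A2n0] := eqVneq A2 0.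
  have A1n0 : A1 != 0.
    apply: contraNneq A00 => A10; move/eqP: nA1; rewrite A10 A20.
    by rewrite !hdot0r mulr0 addr0 eq_sym mulf_eq0 pnatr_eq0 /= hdot_eq0.
  exists ((hnorm A1)^-1 *: A1); rewrite hdot_normalized // !symplZr !hdotZr.
  have -> : hdot A0 A1 = 0.
    move/eqP: h01; rewrite A20 hdot0r.
    by rewrite mulf_eq0 pnatr_eq0 /= => /eqP.
  rewrite o01 symplxx !mulr0 fmorphV /= conj_hnorm.
  split=> //; split=> //; first by rewrite mulr_ge0 ?hdot_ge0 ?invr_ge0 ?hnorm_ge0.
  have -> : hnorm A2 = 0 by apply/eqP; rewrite hnorm_eq0 A20.
  by rewrite scale0r.
have n0 : hnorm A2 != 0 by rewrite hnorm_eq0.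
exists ((hnorm A2)^-1 *: A2); rewrite hdot_normalized // !symplZr !hdotZr.
rewrite o02 h02 o12 !mulr0 fmorphV /= conj_hnorm scalerA divff // scale1r.
by split=> //; split=> //; rewrite mulr_ge0 ?invr_ge0 ?hnorm_ge0.
Qed.

Lemma normal_frame (A0 A1 A2 : 'cV[C]_4) :
  A0 != 0 -> sympl A0 A1 = 0 -> sympl A0 A2 = 0 -> hdot A0 A2 = 0 -> sympl A1 A2 = 0 ->
  2 * hdot A0 A1 = hdot A1 A2 ->
  3 * hdot A1 A1 = 5 * hdot A0 A0 + hdot A2 A2 -> 0 <= hdot A1 A2 ->
  exists u v r m s, [/\ Sp2 (frame_mx u v), [/\ 0 < r, 0 <= m & 0 <= s],
    3 * (m ^+ 2 + (m * s / (2 * r)) ^+ 2) = 5 * r ^+ 2 + s ^+ 2 &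
    [/\ frame_mx u v *m A0 = vec4 r 0 0 0,
        frame_mx u v *m A1 = vec4 (m * s / (2 * r)) 0 m 0 &
        frame_mx u v *m A2 = vec4 0 0 s 0]].
Proof.
move=> A00 o01 o02 h02 o12 h01 nA1 h12.
have [v [vv h0v o0v [o1v h1v A2E]]] := adapted_direction A00 o01 o02 h02 o12 h01 nA1 h12.
set r := hnorm A0; set s := hnorm A2 in A2E; set m := hdot A1 v in h1v.
have r0 : r != 0 by rewrite hnorm_eq0.
have r_gt0 : 0 < r by rewrite lt_neqAle eq_sym r0 hnorm_ge0.
have rc : r^* = r by rewrite conj_hnorm.
have sc : s^* = s by rewrite conj_hnorm.
have mc : m^* = m by apply/CrealP; rewrite ger0_real.
pose u := r^-1 *: A0.
have uu : hdot u u = 1 by rewrite hdot_normalized.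
have uv : hdot u v = 0 by rewrite hdotZl h0v mulr0.
have ouv : sympl u v = 0 by rewrite symplZl o0v mulr0.
have gS := frame_mx_Sp2 uu vv uv ouv; have [_ gU] := gS.
have h1u : hdot A1 u = m * s / (2 * r).
  have -> : m * s = 2 * (hdot A0 A1)^*.
    rewrite -(conjC_nat C 2) -rmorphM /= h01 A2E hdotZr sc rmorphM /= sc mc.
    by rewrite mulrC.
  by rewrite hdotZr fmorphV /= rc hdotC; field.
have h0u : hdot A0 u = r.
  by rewrite hdotZr fmorphV /= rc -[hdot _ _]sqrtCK -/(hnorm A0) -/r expr2 mulKf.
have [g0 g1 g2] : [/\ frame_mx u v *m A0 = vec4 r 0 0 0,
    frame_mx u v *m A1 = vec4 (m * s / (2 * r)) 0 m 0 &
    frame_mx u v *m A2 = vec4 0 0 s 0].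
  rewrite !mul_frame_mx !hdot_qjr h0u h1u h0v o0v o1v -/m oppr0.
  rewrite A2E !hdotZl !symplZl vv symplxx -[hdot v u]hdotC uv (symplC u v) ouv.
  rewrite (symplZr _ A0 A0) symplxx (symplZr _ A1 A0) (symplC A0 A1) o01.
  by rewrite !(oppr0, mulr0, conjC0, mulr1).
exists u, v, r, m, s; split=> //; first by split=> //; exact: hnorm_ge0.
move: nA1; rewrite -(hdot_unitary A1 A1 gU) g1 hdotE !entry_vec4 //=.
rewrite -[hdot A0 A0]sqrtCK -/(hnorm A0) -/r -[hdot A2 A2]sqrtCK -/(hnorm A2) -/s.
move=> <-; rewrite !rmorphM /= fmorphV !rmorphM /= mc sc rc conjC0 conjC_nat.
by ring.
Qed.

Lemma real_complex_ge0 (c : C) : 0 <= c -> c = (complex.Re c)%:C%C.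
Proof. by move=> c0; rewrite RRe_real ?ger0_real. Qed.

(** After division by r^2 the hypothesis reads
    3 mu^2 (1 + eta^2 / 4) = 5 + eta^2 with mu = m / r and eta = s / r; it
    determines mu, because mu is nonnegative. *)
Lemma normal_coefs (r m s : C) : 0 < r -> 0 <= m -> 0 <= s ->
  3 * (m ^+ 2 + (m * s / (2 * r)) ^+ 2) = 5 * r ^+ 2 + s ^+ 2 ->
  exists eta : R, [/\ 0 <= eta, s = r * eta%:C%C, m = r * (mucoef eta)%:C%C &
     m * s / (2 * r) = r * (qcoef eta)%:C%C].
Proof.
move=> r0 m0 s0 eq_rms; have rn0 : r != 0 by rewrite gt_eqF.
have := divr_ge0 s0 (ltW r0); have := divr_ge0 m0 (ltW r0).
move=> /[dup] /real_complex_ge0 + + /[dup] /real_complex_ge0.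
move: (complex.Re (m / r)) (complex.Re (s / r)) => mu eta muE mu0 etaE eta0.
have {}muE : m = r * mu%:C%C by rewrite -muE mulrC divfK.
have {}etaE : s = r * eta%:C%C by rewrite -etaE mulrC divfK.
have {}mu0 : 0 <= mu by rewrite -lecR; move: mu0; rewrite muE mulrAC divff ?mul1r.
have {}eta0 : 0 <= eta by rewrite -lecR; move: eta0; rewrite etaE mulrAC divff ?mul1r.
have eq_mu : 3 * (mu ^+ 2 + (mu * eta / 2) ^+ 2) = 5 + eta ^+ 2.
  apply: complexI; rewrite !(rmorphM, rmorphD, rmorphXn, fmorphV, rmorph_nat) /=.
  apply: (mulfI (expf_neq0 2 rn0)).
  transitivity (5 * r ^+ 2 + s ^+ 2); last by rewrite etaE; ring.
  by rewrite -eq_rms muE etaE; field.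
have muE' : mucoef eta = mu.
  apply/eqP; rewrite -(@eqrXn2 _ 2) //; last first.
    by rewrite /mucoef mulr_ge0 ?divr_ge0 ?sqrtr_ge0.
  rewrite /mucoef !exprMn exprVn !sqr_sqrtr //; last first.
    by rewrite divr_ge0 ?addr_ge0 ?sqr_ge0.
  have e4 : eta ^+ 2 + 4 != 0 by rewrite gt_eqF // ltr_wpDl ?sqr_ge0.
  have -> : eta ^+ 2 + 5 = 3 * (mu ^+ 2 + (mu * eta / 2) ^+ 2).
    by rewrite eq_mu addrC.
  by apply/eqP; field.
exists eta; rewrite muE'; split=> //.
have -> : qcoef eta = eta / 2 * mucoef eta.
  have sqrt3 : Num.sqrt 3 != 0 :> R by rewrite gt_eqF // sqrtr_gt0.
  by rewrite /qcoef /mucoef; field.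
by rewrite muE' muE etaE !(rmorphM, fmorphV, rmorph_nat) /=; field.
Qed.

End NormalForm.

(** * Curves in projective space *)

Section Curves.
Variable R : realType.
Local Notation C := R[i].

Lemma val_pt n (v : 'cV[C]_n.+1) : v != 0 -> val (pt v) = <[v]>%VS.
Proof. by move=> v0; rewrite /pt val_insubd dim_vline v0. Qed.

Lemma ptZ n (c : C) (v : 'cV[C]_n.+1) : c != 0 -> pt (c *: v) = pt v.
Proof.
move=> c0; congr insubd; apply/eqP; rewrite eqEsubv -!memvE.
rewrite memvZ ?memv_line //= -{1}[v]scale1r -(mulVf c0) -scalerA.
by rewrite memvZ ?memv_line.
Qed.

Lemma hcoord_pt n (v : 'cV[C]_n.+1) : v != 0 ->
  exists2 c, c != 0 & hcoord (pt v) = c *: v.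
Proof.
move=> v0; rewrite /hcoord val_pt //.
have /vlineP[c cE] := memv_pick <[v]>.
exists c => //; apply: contraNneq v0 => c0.
have := vpick0 <[v]>; rewrite cE c0 scale0r eqxx -dimv_eq0 dim_vline.
by case: (v == 0).
Qed.

Lemma pt_mul_hcoord (A : 'M[C]_4) (v : 'cV[C]_4) : v != 0 ->
  pt (A *m hcoord (pt v)) = pt (A *m v).
Proof. by move=> /hcoord_pt[c c0 ->]; rewrite -scalemxAr ptZ. Qed.

(** The point [x : y] of S^2. *)
Definition hom_pt (x y : C) : sphere R := if y == 0 then None else Some (x / y).

Lemma hom_ptP (z : sphere R) :
  exists x y, (x != 0) || (y != 0) /\ z = hom_pt x y.
Proof.
case: z => [z|]; first by exists z, 1; rewrite /hom_pt oner_eq0 orbT divr1.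
by exists 1, 0; rewrite /hom_pt eqxx oner_eq0.
Qed.

Lemma mobius_hom_pt (M : 'M[C]_2) x y : (x != 0) || (y != 0) ->
  mobius M (hom_pt x y) = hom_pt (M ord0 ord0 * x + M ord0 ord_max * y)
                           (M ord_max ord0 * x + M ord_max ord_max * y).
Proof.
rewrite /hom_pt; have [-> | y0 _] := eqVneq y 0 => [/[!orbF] x0|] /=.
  rewrite !mulr0 !addr0 mulf_eq0 (negPf x0) orbF.
  by case: ifP => // _; rewrite invfM mulrACA divff // mulr1.
set c := M ord_max ord0; set d := M ord_max ord_max.
have -> : c * (x / y) + d = (c * x + d * y) / y by field.
rewrite mulf_eq0 invr_eq0 (negPf y0) orbF; case: ifPn => // n0.
by congr Some; field; rewrite n0.
Qed.

Definition coefs (f : 'cV[{poly C}]_4) (k : nat) : 'cV[C]_4 :=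
  map_mx (fun p : {poly C} => p`_k) f.

Lemma entry_coefs f k i : entry (coefs f k) i = (entry f i)`_k.
Proof. by rewrite /entry mxE. Qed.

Lemma eval_at_quintic (f : 'cV[{poly C}]_4) z : (forall i, (size (f i ord0) <= 6)%N) ->
  eval_at f z = quintic (coefs f) z 1.
Proof.
move=> szf; apply: entry_inj => i lt_i4; rewrite entry_quintic !entry_coefs /entry mxE.
rewrite (horner_coef_wide _ (szf _)).
rewrite -(big_mkord xpredT (fun k => (f (inord i) ord0)`_k * z ^+ k)) sum6E; ring.
Qed.

Lemma eval_at_neq0 n (f : 'cV[{poly C}]_n) z :
  (exists i, (f i ord0).[z] != 0) -> eval_at f z != 0.
Proof.
by case=> i; apply: contraNneq => /colP/(_ i); rewrite !mxE => ->.
Qed.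

Lemma eval_rev_lift0 n d (f : 'cV[{poly C}]_n) :
  eval_at (rev_lift d f) 0 = map_mx (fun p : {poly C} => p`_d) f.
Proof. by apply/colP => i; rewrite !mxE horner_coef0 coef_poly subn0. Qed.

Lemma top_coef_neq0 n d (f : 'cV[{poly C}]_n.+1) :
  (\max_i size (f i ord0))%N = d.+1 -> map_mx (fun p : {poly C} => p`_d) f != 0.
Proof.
have [|i ->] := @bigop.eq_bigmax _ (fun i => size (f i ord0)); first by rewrite card_ord.
move=> sz_i.
have : lead_coef (f i ord0) != 0 by rewrite lead_coef_eq0 -size_poly_eq0 sz_i.
by apply: contraNneq => /colP/(_ i); rewrite !mxE lead_coefE sz_i => ->.
Qed.

Lemma quinticZ A (c x y : C) : quintic A (c * x) (c * y) = c ^+ 5 *: quintic A x y.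
Proof. by apply: entry_inj => i _; rewrite entryZ !entry_quintic; ring. Qed.

Lemma poly_curve_hom_pt (f : 'cV[{poly C}]_4) x y :
  (forall i, (size (f i ord0) <= 6)%N) -> (x != 0) || (y != 0) ->
  poly_curve 5 f (hom_pt x y) = pt (quintic (coefs f) x y).
Proof.
move=> szf; rewrite /hom_pt.
have [-> | y0 _] := eqVneq y 0 => [/[!orbF] x0|] /=.
  have := quinticZ (coefs f) x 1 0; rewrite mulr1 mulr0 quintic10 => ->.
  by rewrite ptZ ?expf_neq0 // eval_rev_lift0.
have := quinticZ (coefs f) y (x / y) 1; rewrite mulr1 mulrC divfK // => ->.
by rewrite ptZ ?expf_neq0 // eval_at_quintic.
Qed.

Lemma quintic_neq0 (f : 'cV[{poly C}]_4) x y :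
  (forall i, (size (f i ord0) <= 6)%N) ->
  (forall z, exists i, (f i ord0).[z] != 0) -> coefs f 5 != 0 ->
  (x != 0) || (y != 0) -> quintic (coefs f) x y != 0.
Proof.
move=> szf nz f5; have [-> | y0 _] := eqVneq y 0 => [/[!orbF] x0|] /=.
  have := quinticZ (coefs f) x 1 0; rewrite mulr1 mulr0 quintic10 => ->.
  by rewrite scaler_eq0 negb_or f5 expf_neq0.
have := quinticZ (coefs f) y (y^-1 * x) 1.
rewrite mulr1 mulVKf // -eval_at_quintic // => ->.
rewrite scaler_eq0 negb_or expf_neq0 //=.
have [i fi] := nz (y^-1 * x); apply: contraNneq fi => /colP/(_ i).
by rewrite !mxE => ->.
Qed.

Lemma mul_quintic (G : 'M[C]_4) A x y :
  G *m quintic A x y = quintic (fun k => G *m A k) x y.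
Proof.
rewrite /quintic mulmx_sumr; apply: eq_bigr => k _.
by rewrite scalemxAr.
Qed.

(** The lift that defines [Psi5], word for word, so that [Psi5] unfolds to it. *)
Definition Psi5_poly (eta : R) : 'cV[{poly C}]_4 :=
  let q : {poly R[i]} := ((qcoef eta)%:C%C)%:P in
  let mu : {poly R[i]} := ((mucoef eta)%:C%C)%:P in
  let h : {poly R[i]} := (eta%:C%C)%:P in
    (\col_i nth 0 [:: 1 + q * 'X;
                      - q * 'X^4 + 'X^5;
                      mu * 'X + h * 'X^2;
                      h * 'X^3 - mu * 'X^4] i).

Lemma Psi5_polyE (eta : R) (q := (qcoef eta)%:C%C) (mu := (mucoef eta)%:C%C) (h := eta%:C%C) :
  Psi5_poly eta = vec4 (Poly [:: 1; q]) (Poly [:: 0; 0; 0; 0; -q; 1])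
   (Poly [:: 0; mu; h]) (Poly [:: 0; 0; 0; h; - mu]).
Proof.
apply: entry_inj => i lt_i4; rewrite entry_vec4 // /entry mxE inordK //.
by move: i lt_i4 => [|[|[|[|//]]]] _ /=; rewrite !cons_poly_def !(polyCN, polyC0, polyC1); ring.
Qed.

Lemma size_Psi5_poly eta i : (size (Psi5_poly eta i ord0) <= 6)%N.
Proof.
rewrite Psi5_polyE mxE.
by case: i => [[|[|[|[|//]]]] ?]; apply: leq_trans (size_Poly _) _.
Qed.

Lemma coefs_Psi5 (eta : R) (q := (qcoef eta)%:C%C) (mu := (mucoef eta)%:C%C) (h := eta%:C%C) :
  [/\ coefs (Psi5_poly eta) 0 = vec4 1 0 0 0,
      coefs (Psi5_poly eta) 1 = vec4 q 0 mu 0 &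
      coefs (Psi5_poly eta) 2 = vec4 0 0 h 0] /\ qreal (coefs (Psi5_poly eta)).
Proof.
have coE k : coefs (Psi5_poly eta) k = vec4 [:: 1; q]`_k [:: 0; 0; 0; 0; -q; 1]`_k
   [:: 0; mu; h]`_k [:: 0; 0; 0; h; - mu]`_k.
  rewrite Psi5_polyE; apply: entry_inj => i lt_i4; rewrite entry_coefs !entry_vec4 //.
  by move: i lt_i4 => [|[|[|[|//]]]] _; exact: coef_Poly.
split; first by rewrite !coE.
have cR (x : R) : (x%:C%C)^* = x%:C%C := conjc_real x.
move=> k lt_k6; rewrite !coE; apply: entry_inj => i lt_i4; rewrite entryZ.
move: k lt_k6 i lt_i4 => [|[|[|[|[|[|//]]]]]] _ [|[|[|[|//]]]] _;
  by rewrite !entry_vec4 //= ?rmorphN /= ?(conjC0, conjC1, cR); ring.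
Qed.

(** Otherwise the vectors orthogonal to u form a hyperplane that contains the
    curve; at infinity, because the polynomial <f, u> is zero and so is its
    coefficient of degree d. *)
Lemma full_hdot_eq0 n d (f : 'cV[{poly C}]_n.+1) (psi : sphere R -> CP R n) u :
  represents d f psi -> linearly_full psi ->
  (forall z, hdot u (eval_at f z) = 0) -> u = 0.
Proof.
move=> [nz max_d psiE] full u0; apply/eqP; apply: contraT => un0.
pose phi : 'cV[C]_n.+1 -> 'cV[C]_1 := mulmx (u ^t*)%sesqui.
have phiE v : phi v = (hdot v u)%:M.
  rewrite [LHS]mx11_scalar; congr (_%:M).
  by rewrite mxE; apply: eq_bigr => i _; rewrite !mxE mulrC.
have phi_eq0 v : (phi v == 0) = (hdot v u == 0).
  rewrite phiE; apply/eqP/eqP => [/matrixP/(_ 0 0)|->]; last by rewrite raddf0.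
  by rewrite !mxE eqxx.
pose H := lker (linfun phi).
have memH v : (v \in H) = (hdot v u == 0).
  by rewrite memv_ker lfunE /= -phi_eq0.
have dimH : \dim H = n.
  have := limg_ker_dim (linfun phi) fullv; rewrite capfv -/H.
  have -> : \dim (linfun phi @: fullv) = 1.
    apply/eqP; rewrite eqn_leq; apply/andP; split.
      by rewrite (leq_trans (dimvS (subvf _))) // dimvf.
    rewrite lt0n dimv_eq0; apply: contraNneq un0 => im0.
    have := memv_img (linfun phi) (memvf u).
    by rewrite im0 memv0 lfunE /= phi_eq0 hdot_eq0.
  by rewrite dimvf /dim /= muln1 addn1 => -[].
have pt_sub v : v != 0 -> hdot v u = 0 -> (val (pt v) <= H)%VS.
  by move=> v0 vu; rewrite val_pt // -memvE memH vu.
have [] := full H dimH => z; rewrite psiE.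
case: z => [z|] /=; apply: pt_sub.
- exact: eval_at_neq0.
- by rewrite -hdotC u0 conjC0.
- by rewrite eval_rev_lift0 top_coef_neq0.
rewrite eval_rev_lift0.
pose p := \sum_i (u i ord0)^* *: f i ord0.
have p0 : p = 0.
  apply: poly_natr_eq0 => l; transitivity (hdot (eval_at f l%:R) u).
    by rewrite horner_sum; apply: eq_bigr => i _; rewrite hornerZ !mxE mulrC.
  by rewrite -hdotC u0 conjC0.
transitivity p`_d; last by rewrite p0 coef0.
by rewrite coef_sum; apply: eq_bigr => i _; rewrite coefZ !mxE mulrC.
Qed.

End Curves.

(** * Normal form of symmetric horizontal curves *)

Section SymmetricCurves.
Variable R : realType.
Local Notation C := R[i].

(** The substitutions used above have determinant |a|^2 + |b|^2; dividing by
    its square root does not change the Moebius transformation. *)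
Lemma SU2_matrix (a b : C) : a != 0 ->
  exists s : C, s != 0 /\ exists M : 'M[C]_2, [/\ \det M = 1, M \is unitarymx,
    (M ord0 ord0 = s * a /\ M ord0 ord_max = s * b) &
    (M ord_max ord0 = s * - b^* /\ M ord_max ord_max = s * a^*)].
Proof.
move=> a0; pose n := sqrtC (a * a^* + b * b^*).
have n2 : n ^+ 2 = a * a^* + b * b^* by rewrite sqrtCK.
have n20 : 0 < a * a^* + b * b^*.
  by rewrite ltr_pwDl -?normCK ?exprn_ge0 ?exprn_gt0 ?normr_gt0.
have n0 : n != 0 by rewrite sqrtC_eq0 gt_eqF.
have nc : n^* = n by apply/CrealP; rewrite ger0_real ?sqrtC_ge0 ?ltW.
exists n^-1; split; first by rewrite invr_eq0.
pose r (i j : nat) := nth 0 (nth [::] [:: [:: a; b]; [:: - b^*; a^*]] i) j.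
exists (\matrix_(i < 2, j < 2) (n^-1 * r i j)); split; last 2 first.
- by rewrite !mxE.
- by rewrite !mxE.
- rewrite (expand_det_row _ ord0) !big_ord_recl big_ord0 /cofactor !det_mx11 !mxE /r /=.
  transitivity ((a * a^* + b * b^*) / n ^+ 2); first by field.
  by rewrite n2 divff ?gt_eqF.
apply/unitarymxP/matrixP => i j; rewrite !mxE !big_ord_recl big_ord0 !mxE /=.
case: i => [[|[|//]] ?]; case: j => [[|[|//]] ?];
  rewrite /r /= ?rmorphM ?fmorphV /= nc ?rmorphN /= ?conjCK.
- transitivity ((a * a^* + b * b^*) / n ^+ 2); first by field.
  by rewrite n2 divff ?gt_eqF.
- by ring.
- by ring.
transitivity ((a * a^* + b * b^*) / n ^+ 2); first by field.
by rewrite n2 divff ?gt_eqF.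
Qed.

(** All the normalizations together. It suffices to compare the coefficients of
    index 0, 1, 2: both curves are symmetric, and elements of Sp(2) commute
    with j. *)
Lemma normal_form_of_qreal (A : nat -> 'cV[C]_4) (psi : sphere R -> CP R 3) :
  (forall x y, (x != 0) || (y != 0) -> quintic A x y != 0) ->
  (forall x y, (x != 0) || (y != 0) -> psi (hom_pt x y) = pt (quintic A x y)) ->
  qreal A -> horizontal A ->
  exists (g : CP R 3 -> CP R 3) (omega : sphere R -> sphere R) (eta : R),
    [/\ PSp2 g, PSU2 omega, 0 <= eta & forall z, g (psi (omega z)) = Psi5 eta z].
Proof.
move=> A_neq0 psiE rA hA.
have [a [b [B [a0 BE rB hB [o12 h12]]]]] := normal_rotation rA hA.
have [o01 o02 h02 h01 n1] := horizontal_relations rB hB o12.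
have B0 : B 0%N != 0.
  rewrite -quintic01 BE !mulr0 !add0r !mulr1.
  by rewrite A_neq0 // conjC_eq0 a0 orbT.
have [u [v [r [m [s [gS [r0 m0 s0] eq_rms [g0 g1 g2]]]]]]] :=
  normal_frame B0 o01 o02 h02 o12 h01 n1 h12.
have [eta [eta0 sE mE qE]] := normal_coefs r0 m0 s0 eq_rms.
have [n [n0 [M [detM uniM [M00 M01] [M10 M11]]]]] := SU2_matrix b a0.
pose G := frame_mx u v.
exists (fun p => pt (G *m hcoord p)), (mobius M), eta; split=> //.
- by exists G.
- by exists M.
have GB k : (k < 6)%N -> G *m B k = r *: coefs (Psi5_poly eta) k.
  have [[P0 P1 P2] rP] := coefs_Psi5 eta.
  have low j : (j < 3)%N -> G *m B j = r *: coefs (Psi5_poly eta) j.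
    move: j => [|[|[|//]]] _.
    - rewrite g0 P0; apply: entry_inj => -[|[|[|[|//]]]] _;
        by rewrite entryZ !entry_vec4 //= ?mulr1 ?mulr0.
    - rewrite g1 P1 qE mE; apply: entry_inj => -[|[|[|[|//]]]] _;
        by rewrite entryZ !entry_vec4 //= ?mulr1 ?mulr0.
    - rewrite g2 P2 sE; apply: entry_inj => -[|[|[|[|//]]]] _;
        by rewrite entryZ !entry_vec4 //= ?mulr1 ?mulr0.
  have [lt_k3 _ | le3k lt_k6] := ltnP k 3; first exact: low.
  have lt_5k : (5 - k < 3)%N by rewrite ltnS leq_subLR (leq_add le3k (leqnn 2)).
  have lt_5k6 : (5 - k < 6)%N by rewrite ltnS leq_subr.
  (* The coefficients of index 3, 4, 5 are images under j of the first three. *)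
  have kE : k = (5 - (5 - k))%N by rewrite subKn.
  rewrite kE rB // rP // -scalemxAr frame_mx_qj low // qjZ.
  have -> : r^* = r by apply/CrealP; rewrite gtr0_real.
  by rewrite !scalerA mulrC.
move=> z; have [x [y [xy0 ->]]] := hom_ptP z.
rewrite mobius_hom_pt // M00 M01 M10 M11 -!mulrA -!mulrDr.
set X := a * x + b * y; set Y := - b^* * x + a^* * y.
have XY0 : (X != 0) || (Y != 0).
  rewrite -negb_and; apply: contraL xy0 => /andP[/eqP X0 /eqP Y0].
  have n20 : a * a^* + b * b^* != 0.
    by rewrite gt_eqF // ltr_pwDl -?normCK ?exprn_ge0 ?exprn_gt0 ?normr_gt0.
  have x0 : (a * a^* + b * b^*) * x = 0.
    transitivity (a^* * X - b * Y); first by rewrite /X /Y; ring.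
    by rewrite X0 Y0; ring.
  have y0 : (a * a^* + b * b^*) * y = 0.
    transitivity (b^* * X + a * Y); first by rewrite /X /Y; ring.
    by rewrite X0 Y0; ring.
  move: x0 y0 => /eqP; rewrite mulf_eq0 (negPf n20) => /eqP-> /eqP.
  by rewrite mulf_eq0 (negPf n20) => /eqP->; rewrite eqxx.
rewrite psiE; last by rewrite !mulf_eq0 !negb_or n0.
rewrite pt_mul_hcoord; last first.
  by rewrite A_neq0 // !mulf_eq0 !negb_or n0.
rewrite quinticZ -scalemxAr ptZ ?expf_neq0 // -BE mul_quintic.
rewrite /Psi5 -/(Psi5_poly eta) poly_curve_hom_pt //; last exact: size_Psi5_poly.
have -> : quintic (fun k => G *m B k) x y = r *: quintic (coefs (Psi5_poly eta)) x y.
  rewrite /quintic scaler_sumr; apply: eq_big_nat => k /andP[_ lt_k6].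
  by rewrite GB // !scalerA mulrC.
by rewrite ptZ // gt_eqF.
Qed.

End SymmetricCurves.

(** * The twistor fibration *)

Section Twistor.
Variable R : realType.
Local Notation C := R[i].
Implicit Types v w : 'cV[C]_4.

Lemma complex_nsq (z : C) : (nsq z)%:C%C = z * z^*.
Proof. by rewrite -normCK -add_Re2_Im2. Qed.

Lemma complex_nsqD (y z : C) : (nsq y + nsq z)%:C%C = y * y^* + z * z^*.
Proof. by rewrite (rmorphD _ (nsq y) (nsq z)) /= !complex_nsq. Qed.

Lemma nsqM (y z : C) : nsq (y * z) = nsq y * nsq z.
Proof. by case: y z => [a b] [c d]; rewrite /nsq /=; ring. Qed.

Lemma nsq_ge0 (z : C) : 0 <= nsq z.
Proof. by rewrite addr_ge0 ?sqr_ge0. Qed.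

Lemma nsq_eq0 (z : C) : nsq z = 0 -> z = 0.
Proof.
by move=> z0; apply/eqP; rewrite -normr_eq0 -sqrf_eq0 normCK -complex_nsq z0.
Qed.

(** [hopf_a] and [hopf_b] are half the two complex coordinates of the twistor
    fibration before normalization; [nsq_top] and [nsq_bot] are the squared
    norms of the two quaternionic coordinates. *)
Definition hopf_a v : C := (entry v 0)^* * entry v 2 + entry v 1 * (entry v 3)^*.
Definition hopf_b v : C := (entry v 0)^* * entry v 3 - entry v 1 * (entry v 2)^*.
Definition nsq_top v : R := nsq (entry v 0) + nsq (entry v 1).
Definition nsq_bot v : R := nsq (entry v 2) + nsq (entry v 3).

Lemma addr_ge0_nsq (a b : C) : 0 <= nsq a + nsq b.
Proof. by rewrite addr_ge0 // nsq_ge0. Qed.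

Lemma addr_eq0_nsq (a b : C) : nsq a + nsq b = 0 -> a = 0 /\ b = 0.
Proof.
move=> /eqP; rewrite paddr_eq0 ?nsq_ge0 // => /andP[/eqP ? /eqP ?].
by split; apply: nsq_eq0.
Qed.

Lemma nsq_top_bot_gt0 v : v != 0 -> 0 < nsq_top v + nsq_bot v.
Proof.
move=> v0; rewrite lt_neqAle addr_ge0 ?addr_ge0_nsq // andbT.
apply: contraNneq v0 => /esym/eqP.
rewrite paddr_eq0 ?addr_ge0_nsq // => /andP[/eqP z01 /eqP z23].
apply/eqP/entry_inj; have [z0 z1] := addr_eq0_nsq z01; have [z2 z3] := addr_eq0_nsq z23.
by move=> [|[|[|[|//]]]] _; rewrite entry0.
Qed.

Lemma twistor_homE v : twistor_hom v = (nsq_top v + nsq_bot v)^-1 *: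
  \row_k nth 0 [:: complex.Re (2 * hopf_a v); complex.Im (2 * hopf_a v);
    complex.Re (2 * hopf_b v); complex.Im (2 * hopf_b v); nsq_top v - nsq_bot v] k.
Proof.
rewrite /twistor_hom /nsq_top /nsq_bot -!/(entry v _) -/(hopf_a v) -/(hopf_b v).
have eD (a b c d : R) : a + b + c + d = a + b + (c + d) by rewrite addrA.
have eB (a b c d : R) : a + b - c - d = a + b - (c + d) by rewrite opprD addrA.
by rewrite eD eB.
Qed.

(** Equality of all the unnormalized coordinates up to a common real factor,
    which is what equality under the twistor fibration amounts to. *)
Definition hopf_scale (l : R) v w := [/\ hopf_a w = l%:C%C * hopf_a v,
  hopf_b w = l%:C%C * hopf_b v, nsq_top w = l * nsq_top v & nsq_bot w = l * nsq_bot v].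

Lemma Re_scale (l : R) (z : C) : complex.Re (l%:C%C * z) = l * complex.Re z.
Proof. by case: z => a b /=; rewrite mul0r subr0. Qed.
Lemma Im_scale (l : R) (z : C) : complex.Im (l%:C%C * z) = l * complex.Im z.
Proof. by case: z => a b /=; rewrite mul0r addr0. Qed.

Lemma twistor_hom_scale l v w : l != 0 -> hopf_scale l v w ->
  twistor_hom w = twistor_hom v.
Proof.
move=> l0 [ha hb ht hn]; rewrite !twistor_homE ha hb ht hn.
rewrite -!mulrDr -!mulrBr !(mulrCA 2) !Re_scale !Im_scale invfM -scalerA.
rewrite [_ *: _ in RHS]/=.
apply/rowP => k; rewrite !mxE.
suff -> : nth 0
 [:: l * complex.Re (2 * hopf_a v); l * complex.Im (2 * hopf_a v);
     l * complex.Re (2 * hopf_b v); l * complex.Im (2 * hopf_b v);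
     l * (nsq_top v - nsq_bot v)] k = l * nth 0
 [:: complex.Re (2 * hopf_a v); complex.Im (2 * hopf_a v);
     complex.Re (2 * hopf_b v); complex.Im (2 * hopf_b v);
     (nsq_top v - nsq_bot v)] k.
  by rewrite mulrCA mulKf.
by case: k => [[|[|[|[|[|//]]]]] ?].
Qed.

Lemma hopf_scale_twistor v w : v != 0 -> w != 0 -> twistor_hom w = twistor_hom v ->
  exists2 l, l != 0 & hopf_scale l v w.
Proof.
move=> /nsq_top_bot_gt0 nv0 /nsq_top_bot_gt0 nw0; rewrite !twistor_homE => /rowP eq_vw.
move: (lt0r_neq0 nv0) (lt0r_neq0 nw0) eq_vw => {nv0 nw0}.
set nv := nsq_top v + nsq_bot v; set nw := nsq_top w + nsq_bot w => nv0 nw0 eq_vw.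
have eqk k (lt_k5 : (k < 5)%N) := eq_vw (Ordinal lt_k5).
have sc (x y : R) : nw^-1 * x = nv^-1 * y -> x = nw / nv * y.
  by move=> eq_xy; rewrite -mulrA -eq_xy mulVKf.
have scC (x y : C) : nw^-1 * complex.Re (2 * x) = nv^-1 * complex.Re (2 * y) ->
    nw^-1 * complex.Im (2 * x) = nv^-1 * complex.Im (2 * y) -> x = (nw / nv)%:C%C * y.
  move=> /sc eqR /sc eqI; apply: (@mulfI _ 2); first by rewrite pnatr_eq0.
  by apply/eqP; rewrite eq_complex mulrCA Re_scale Im_scale eqR eqI !eqxx.
have := eqk 0%N isT; have := eqk 1%N isT; have := eqk 2%N isT; have := eqk 3%N isT.
have := eqk 4%N isT; rewrite !mxE /= => /sc e4 e3 e2 e1 e0.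
exists (nw / nv); first by rewrite mulf_neq0 ?invr_eq0.
have eqn : nsq_top w + nsq_bot w = nw / nv * (nsq_top v + nsq_bot v).
  by rewrite -/nv divfK.
split; try exact: scC.
  apply: (@mulfI _ 2); first by rewrite pnatr_eq0.
  transitivity ((nsq_top w + nsq_bot w) + (nsq_top w - nsq_bot w)); first by ring.
  by rewrite eqn e4; ring.
apply: (@mulfI _ 2); first by rewrite pnatr_eq0.
transitivity ((nsq_top w + nsq_bot w) - (nsq_top w - nsq_bot w)); first by ring.
by rewrite eqn e4; ring.
Qed.

Lemma hopf_scaleZ (c : C) v : hopf_scale (nsq c) v (c *: v).
Proof.
split; rewrite /hopf_a /hopf_b /nsq_top /nsq_bot !entryZ.
1,2: by rewrite complex_nsq !rmorphM /=; ring.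
all: by rewrite !nsqM -mulrDr.
Qed.

(** The curve t |-> [v + t j v] stays in the fibre through [v]. *)
Lemma hopf_scale_qj (t : R) v : hopf_scale (1 + t ^+ 2) v (v + t%:C%C *: qj v).
Proof.
have tc : (t%:C%C)^* = t%:C%C := conjc_real t.
have lE : (1 + t ^+ 2)%:C%C = 1 + t%:C%C ^+ 2 by rewrite rmorphD rmorphXn rmorph1.
split; rewrite /hopf_a /hopf_b /nsq_top /nsq_bot !entryD !entryZ !entry_vec4 //=.
1,2: by rewrite lE !(rmorphD, rmorphM, rmorphN) /= !conjCK tc; ring.
all: by apply: complexI; rewrite complex_nsqD rmorphM /= complex_nsqD lE;
  rewrite !(rmorphD, rmorphM, rmorphN) /= !conjCK tc; ring.
Qed.

Lemma twistor_pt v : v != 0 -> twistor (pt v) = twistor_hom v.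
Proof.
move=> /hcoord_pt[c c0 cE]; rewrite /twistor cE.
apply: twistor_hom_scale (hopf_scaleZ c v).
by apply: contra_neq c0 => /nsq_eq0.
Qed.

Lemma vertical_qj v : vertical v (qj v).
Proof.
split; first by rewrite qj_hdotl hdot_qjr symplxx !oppr0 conjC0 oppr0.
have -> : (fun t : R => twistor_hom (v + t%:C%C *: qj v)) = cst (twistor_hom v).
  apply/funext => t /=; apply: twistor_hom_scale (hopf_scale_qj t v).
  by rewrite gt_eqF // ltr_pwDl ?sqr_ge0.
exact: is_derive_cst.
Qed.

(** Horizontality against the vertical vector j v gives Re (c omega(v, f')) = 0
    for every c, up to a positive factor; taking for c the conjugate of the
    number gives the square of its modulus. *)
Lemma horizontal_at_sympl (f : 'cV[{poly C}]_4) z : eval_at f z != 0 ->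
  horizontal_at f z -> sympl (eval_at f z) (eval_at (map_mx (@deriv _) f) z) = 0.
Proof.
move=> fz0 hf; set v := eval_at f z; set w := eval_at _ z.
have nv0 : hdot v v != 0 by rewrite hdot_eq0.
have := hf _ _ (vertical_qj v); rewrite /fubini_study /tangent_proj -/v -/w.
set d := sympl v w => hc.
have dE c (a := hdot (c *: w) v / hdot v v) : hdot (c *: w - a *: v) (qj v) = c * d.
  have omN : sympl (- (a *: v)) v = 0 by rewrite -scaleNr symplZl symplxx mulr0.
  by rewrite hdot_qjr symplDl omN symplZl addr0 -mulrN -symplC.
(* <c f' - a v, j v> = c d, since <v, j v> = 0. *)
have := hc ((d / hdot v v)^*); rewrite dE -mulrA mulrC.
rewrite -complex_nsq /= => /nsq_eq0/eqP; rewrite mulf_eq0 invr_eq0 (negPf nv0) orbF.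
by move/eqP.
Qed.

End Twistor.

(** * Antipodal invariance *)

Section Antipodal.
Variable R : realType.
Local Notation C := R[i].

(** The function is a polynomial in z and conj z. Writing z = x + i y and
    conj z = x - i y, it vanishes when x and y are natural numbers, hence for
    all complex x and y, and then the two factors can be given independent
    values. *)
Lemma polarization n (m f : 'cV[{poly C}]_n) :
  (forall z, hdot (eval_at m z) (eval_at f z) = 0) ->
  forall z w, hdot (eval_at m z) (eval_at f w) = 0.
Proof.
move=> diag0 z w.
pose fc i := map_poly Num.conj (f i ord0).
pose P (a b : {poly C}) := \sum_i (m i ord0 \Po a) * (fc i \Po b).
have PE a b t : (P a b).[t] = hdot (eval_at m a.[t]) (eval_at f (b.[t])^*).
  rewrite horner_sum; apply: eq_bigr => i _.
  by rewrite hornerM !horner_comp !mxE -horner_map /= conjCK.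
have P1 (k : nat) : P ('X + ('i * k%:R)%:P) ('X - ('i * k%:R)%:P) = 0.
  apply: poly_natr_eq0 => l; rewrite PE !(hornerD, hornerN, hornerX, hornerC).
  by rewrite rmorphB rmorphM /= conjCi !conjC_nat mulNr opprK diag0.
have P2 (x : C) : P (x%:P + 'i *: 'X) (x%:P - 'i *: 'X) = 0.
  apply: poly_natr_eq0 => k.
  rewrite PE !(hornerD, hornerN, hornerZ, hornerX, hornerC).
  have /= := congr1 (horner^~ x) (P1 k).
  by rewrite PE !(hornerD, hornerN, hornerX, hornerC) ?horner0.
have /= := congr1 (horner^~ ((z - w^*) / (2 * 'i))) (P2 ((z + w^*) / 2)).
rewrite PE !(hornerD, hornerN, hornerZ, hornerX, hornerC) ?horner0.
have i0 : 'i != 0 :> C by rewrite neq0Ci.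
have -> : (z + w^*) / 2 + 'i * ((z - w^*) / (2 * 'i)) = z by field.
have -> : (z + w^*) / 2 - 'i * ((z - w^*) / (2 * 'i)) = w^* by field.
by rewrite conjCK.
Qed.

(** Pluecker coordinates of the line spanned by y and z. *)
Definition wedge (T : pzRingType) (y z : 'cV[T]_4) i j : T :=
  entry y i * entry z j - entry y j * entry z i.

(** The 3x3 minors of (j u, y, z) on the rows 0, 1, 2, respectively 0, 1, 3 and
    0, 2, 3, are conjugate-linear in u. The vectors defined here represent these
    forms through the Hermitian product: see [hdot_contractE]. Together they
    contain all the six Pluecker coordinates of y and z. *)
Definition contract012 (T : pzRingType) (y z : 'cV[T]_4) : 'cV[T]_4 :=
  vec4 (- wedge y z 0 2) (- wedge y z 1 2) 0 (- wedge y z 0 1).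
Definition contract013 (T : pzRingType) (y z : 'cV[T]_4) : 'cV[T]_4 :=
  vec4 (- wedge y z 0 3) (- wedge y z 1 3) (wedge y z 0 1) 0.
Definition contract023 (T : pzRingType) (y z : 'cV[T]_4) : 'cV[T]_4 :=
  vec4 0 (- wedge y z 2 3) (wedge y z 0 2) (wedge y z 0 3).

Lemma hopf_scale_qjr l (v w : 'cV[C]_4) : hopf_scale l v w -> hopf_scale l v (qj w).
Proof.
have nsqJ (z : C) : nsq z^* = nsq z.
  by apply: complexI; rewrite !complex_nsq conjCK mulrC.
have nsqN (z : C) : nsq (- z) = nsq z.
  by apply: complexI; rewrite !complex_nsq rmorphN /= mulrNN.
rewrite /hopf_scale /hopf_a /hopf_b /nsq_top /nsq_bot !entry_vec4 //=.
rewrite !nsqN !nsqJ !rmorphN /= !conjCK [nsq (entry w 1) + _]addrC [nsq (entry w 3) + _]addrC.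
by move=> [<- <- <- <-]; split=> //; ring.
Qed.

(** Where the first quaternionic coordinate is nonzero, a fibre is the graph of a
    quaternionic-linear map, whose coefficients P and Q depend only on the point
    of S^4 under the fibre. *)
Lemma hopf_graph l (v x : 'cV[C]_4) (N := (nsq_top v)%:C%C)
    (P := hopf_a v / N) (Q := (hopf_b v)^* / N) :
  l != 0 -> nsq_top v != 0 -> hopf_scale l v x ->
  entry x 2 = P * entry x 0 - Q * entry x 1 /\ entry x 3 = P^* * entry x 1 + Q^* * entry x 0.
Proof.
move=> l0 N0 [ha hb ht _]; pose L := l%:C%C * N.
have NC0 : N != 0 by apply: contra_neq N0 => /complexI.
have lC0 : l%:C%C != 0 :> C by apply: contra_neq l0 => /complexI.
have L0 : L != 0 by rewrite mulf_neq0.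
have LE : L = entry x 0 * (entry x 0)^* + entry x 1 * (entry x 1)^*.
  by rewrite -complex_nsqD -/(nsq_top x) ht rmorphM.
have Nc : N^* = N := conjc_real _.
have aE : P = hopf_a x / L.
  by rewrite ha /P /L; field; rewrite NC0 lC0.
have lc : (l%:C%C)^* = l%:C%C := conjc_real _.
have bE : Q = (hopf_b x)^* / L.
  by rewrite hb rmorphM /= lc /Q /L; field; rewrite NC0 lC0.
have Lc : L^* = L by rewrite LE !(rmorphD, rmorphM) /= !conjCK; ring.
rewrite aE bE !rmorphM fmorphV /= Lc conjCK; split; apply: (mulfI L0).
  transitivity (hopf_a x * entry x 0 - (hopf_b x)^* * entry x 1); last by field.
  rewrite {1}LE /hopf_a /hopf_b !(rmorphB, rmorphM) /= !conjCK; ring.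
transitivity ((hopf_a x)^* * entry x 1 + hopf_b x * entry x 0); last by field.
by rewrite {1}LE /hopf_a /hopf_b !(rmorphD, rmorphM) /= !conjCK; ring.
Qed.

Lemma hdot_contractE (u y z : 'cV[C]_4) :
  [/\ hdot (contract012 y z) u = entry (qj u) 0 * wedge y z 1 2
        - entry (qj u) 1 * wedge y z 0 2 + entry (qj u) 2 * wedge y z 0 1,
      hdot (contract013 y z) u = entry (qj u) 0 * wedge y z 1 3
        - entry (qj u) 1 * wedge y z 0 3 + entry (qj u) 3 * wedge y z 0 1 &
      hdot (contract023 y z) u = entry (qj u) 0 * wedge y z 2 3
        - entry (qj u) 2 * wedge y z 0 3 + entry (qj u) 3 * wedge y z 0 2].
Proof. by split; rewrite hdotE !entry_vec4 //=; ring. Qed.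

(** The vectors v, j v and j w lie on the same fibre, hence in a plane, so their
    3x3 minors vanish. The fibre is either a graph over the first quaternionic
    coordinate or the line where that coordinate is zero. *)
Lemma twistor_contract (v w : 'cV[C]_4) : v != 0 -> w != 0 ->
  twistor_hom w = twistor_hom v ->
  [/\ hdot (contract012 v (qj w)) v = 0, hdot (contract013 v (qj w)) v = 0 &
      hdot (contract023 v (qj w)) v = 0].
Proof.
move=> v0 w0 /(hopf_scale_twistor v0 w0)[l l0 hvw].
have [-> -> ->] := hdot_contractE v v (qj w).
have hvv : hopf_scale 1 v v by split; rewrite mul1r.
have hqv := hopf_scale_qjr hvv; have {}hvw' := hopf_scale_qjr hvw.
have [top0 | top_n0] := eqVneq (nsq_top v) 0.
  have [_ _ + _] := hvw'; rewrite top0 mulr0 => /addr_eq0_nsq[w0' w1'].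
  have [_ _ + _] := hqv; rewrite top0 mulr0 => /addr_eq0_nsq[q0 q1].
  have [v0' v1'] := addr_eq0_nsq top0.
  by rewrite /wedge q0 q1 v0' v1' w0' w1'; split; ring.
have [v2 v3] := hopf_graph (oner_neq0 _) top_n0 hvv.
have [q2 q3] := hopf_graph (oner_neq0 _) top_n0 hqv.
have [w2 w3] := hopf_graph l0 top_n0 hvw'.
by rewrite /wedge q2 q3 v2 v3 w2 w3; split; ring.
Qed.

Lemma eval_at_quinticx (f : 'cV[{poly C}]_4) z : (forall i, (size (f i ord0) <= 6)%N) ->
  eval_at (map_mx (@deriv _) f) z = quinticx (coefs f) z 1.
Proof.
move=> szf; apply: entry_inj => i lt_i4; rewrite entry_quinticx !entry_coefs /entry !mxE.
have sz5 : (size (f (inord i) ord0)^`() <= 5)%N.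
  by rewrite (leq_trans (size_poly _ _)) // -subn1 leq_subLR szf.
rewrite (horner_coef_wide _ sz5) !big_ord_recl big_ord0 /= !coef_deriv /bump /=.
by ring.
Qed.

Lemma eval_wedge (f g : 'cV[{poly C}]_4) z i j :
  (wedge f g i j).[z] = wedge (eval_at f z) (eval_at g z) i j.
Proof. by rewrite /wedge hornerD hornerN !hornerM /entry !mxE. Qed.

Lemma eval_contract (f g : 'cV[{poly C}]_4) z :
  [/\ eval_at (contract012 f g) z = contract012 (eval_at f z) (eval_at g z),
      eval_at (contract013 f g) z = contract013 (eval_at f z) (eval_at g z) &
      eval_at (contract023 f g) z = contract023 (eval_at f z) (eval_at g z)].
Proof.
have ev (a b c d : {poly C}) : eval_at (vec4 a b c d) z = vec4 a.[z] b.[z] c.[z] d.[z].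
  by apply: entry_inj => -[|[|[|[|//]]]] _; rewrite entry_vec4 // /entry !mxE inordK.
by rewrite !ev !hornerN horner0 !eval_wedge.
Qed.

Lemma contract_eq0 (y z : 'cV[C]_4) : contract012 y z = 0 -> contract013 y z = 0 ->
  contract023 y z = 0 ->
  forall i j, (i < 4)%N -> (j < 4)%N -> wedge y z i j = 0.
Proof.
have coE (u : 'cV[C]_4) k : u = 0 -> entry u k = 0 by move=> ->; rewrite entry0.
have wC i j : wedge y z i j = - wedge y z j i by rewrite /wedge opprB.
move=> c3 c2 c1.
have := coE _ 0%N c3; have := coE _ 1%N c3; have := coE _ 3%N c3.
have := coE _ 0%N c2; have := coE _ 1%N c2; have := coE _ 1%N c1.
rewrite !entry_vec4 //= => /eqP; rewrite oppr_eq0 => /eqP p23.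
move=> /eqP; rewrite oppr_eq0 => /eqP p13 /eqP; rewrite oppr_eq0 => /eqP p03.
move=> /eqP; rewrite oppr_eq0 => /eqP p01 /eqP; rewrite oppr_eq0 => /eqP p12.
move=> /eqP; rewrite oppr_eq0 => /eqP p02.
have wii i : wedge y z i i = 0 by rewrite /wedge subrr.
(* Generalizing [wedge y z] keeps the case analysis below from comparing the
   coordinates of y and z up to conversion. *)
move: (wedge y z) wC wii p01 p02 p03 p12 p13 p23 => p pC pii p01 p02 p03 p12 p13 p23.
have lt_p i j : (i < j)%N -> (j < 4)%N -> p i j = 0.
  by move: i j => [|[|[|i]]] [|[|[|[|j]]]].
move=> i j lt_i4 lt_j4; have [lt_ij|lt_ji|->] := ltngtP i j; last exact: pii.
  exact: lt_p.
by rewrite pC lt_p ?oppr0.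
Qed.

(** With h(z) = z^5 j f(-1 / conj z), all the 2x2 minors of (f, h) vanish, so
    that h = g f because the entries of f are coprime, and g is a constant c by
    comparison of degrees. Applying j twice shows |c| = 1, and a square root of
    c is the factor that makes f symmetric. *)
Lemma antipodal_qreal (f : 'cV[{poly C}]_4) (psi : sphere R -> CP R 3) (A := coefs f) :
  represents 5 f psi -> linearly_full psi ->
  (forall z, twistor (psi (antipodal z)) = twistor (psi z)) ->
  exists2 t : C, t != 0 & qreal (fun k => t *: A k).
Proof.
move=> repf full anti; have [nz max_size psiE] := repf.
have szf i : (size (f i ord0) <= 6)%N by rewrite -max_size (leq_bigmax i).
have A5 : A 5%N != 0 by exact: top_coef_neq0.
have A_neq0 x y : (x != 0) || (y != 0) -> quintic A x y != 0 by exact: quintic_neq0.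
have tw x y : (x != 0) || (y != 0) ->
    twistor (psi (hom_pt x y)) = twistor_hom (quintic A x y).
  by move=> xy0; rewrite psiE poly_curve_hom_pt // twistor_pt ?A_neq0.
have w1 (w : C) : (w != 0) || (1 != 0 :> C) by rewrite oner_neq0 orbT.
have s1 (w : C) : (-1 != 0 :> C) || (w^* != 0 :> C) by rewrite oppr_eq0 oner_neq0.
(* The antipode of [z : 1] is [-1 : conj z]. *)
have twE z : twistor_hom (quintic A (-1) z^*) = twistor_hom (quintic A z 1).
  rewrite -[LHS]tw // -[RHS]tw //.
  rewrite -[RHS]anti; congr (twistor (psi _)).
  rewrite /hom_pt oner_eq0 divr1 /= conjC_eq0.
  by case: ifP => // _; rewrite mulN1r.
(* The coefficients of z^5 j f(-1 / conj z). *)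
pose B k := - (-1) ^+ k *: qj (A (5 - k)%N).
pose h : 'cV[{poly C}]_4 := \col_i \poly_(k < 6) B k i ord0.
have szh i : (size (h i ord0) <= 6)%N by rewrite mxE size_poly.
have coefs_h k : (k < 6)%N -> coefs h k = B k.
  by move=> lt_k6; apply/colP => i; rewrite mxE [h _ _]mxE coef_poly lt_k6.
have hE z : eval_at h z = qj (quintic A (-1) z^*).
  rewrite eval_at_quintic // qj_quintic conjCK rmorphN1.
  rewrite -[RHS]opprK quintic_rev /quintic -sumrN.
  apply: eq_big_nat => k /andP[_ lt_k6].
  by rewrite coefs_h // /B scaleNr scalerN.
have contr0 z : [/\ contract012 (eval_at f z) (eval_at h z) = 0,
    contract013 (eval_at f z) (eval_at h z) = 0 & contract023 (eval_at f z) (eval_at h z) = 0].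
  have diag0 w := twistor_contract (A_neq0 w 1 (w1 w)) (A_neq0 (-1) w^* (s1 w)) (twE w).
  have {}diag0 w : [/\ hdot (eval_at (contract012 f h) w) (eval_at f w) = 0,
      hdot (eval_at (contract013 f h) w) (eval_at f w) = 0 &
      hdot (eval_at (contract023 f h) w) (eval_at f w) = 0].
    have [-> -> ->] := eval_contract f h w.
    by rewrite hE eval_at_quintic.
  have [<- <- <-] := eval_contract f h z.
  by split; apply: (full_hdot_eq0 repf full) => w; apply: polarization => {}w;
    have [] := diag0 w.
have wedge0 (i j : 'I_4) : wedge f h i j = 0.
  apply: poly_natr_eq0 => n; rewrite eval_wedge.
  by have [c3 c2 c1] := contr0 n%:R; apply: contract_eq0.
have [u u1] := Bezout_closed nz.
pose g := \sum_i u i * h i ord0.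
have hgf j : h j ord0 = g * f j ord0.
  rewrite -[LHS]mul1r -u1 /g !big_distrl /=; apply: eq_bigr => i _.
  rewrite -!mulrA; congr (_ * _).
  by have /eqP := wedge0 i j; rewrite subr_eq0 /entry !inord_val => /eqP ->; rewrite mulrC.
have [c gE] : exists c, g = c%:P.
  have [|l] := @bigop.eq_bigmax _ (fun i => size (f i ord0)); first by rewrite card_ord.
  rewrite max_size => /esym sz_l.
  exists g`_0; apply: size1_polyC; have [->|g0] := eqVneq g 0; first by rewrite size_poly0.
  have := szh l; rewrite hgf size_mul //; last by rewrite -size_poly_eq0 sz_l.
  by rewrite sz_l addnS /= -[6%N]/(1 + 5)%N leq_add2r.
have BE k : (k < 6)%N -> B k = c *: A k.
  move=> lt_k6; rewrite -coefs_h //; apply/colP => i.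
  by rewrite [LHS]mxE hgf gE coefCM [RHS]mxE [A k _ _]mxE.
have qjA k : (k < 6)%N -> (-1) ^+ k *: qj (A k) = c *: A (5 - k)%N.
  move=> lt_k6; rewrite -BE ?ltnS ?leq_subr // /B subKn; last by rewrite -ltnS.
  congr (_ *: _).
  by move: k lt_k6 => [|[|[|[|[|[|//]]]]]] _; rewrite ?subSS ?subn0 ?sub0n; ring.
(* A_0 = - j (j A_0) = |c|^2 A_0. *)
have cc : c * c^* = 1.
  have A0 : A 0%N != 0 by rewrite -quintic01 A_neq0 // oner_neq0 orbT.
  have e0 : qj (A 0%N) = c *: A 5%N by rewrite -[LHS]scale1r (qjA 0%N).
  have e5 : qj (A 5%N) = - (c *: A 0%N).
    have m5 : (-1) ^+ 5 = -1 :> C by ring.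
    by have := congr1 -%R (qjA 5%N isT); rewrite m5 scaleN1r opprK.
  have := congr1 (@qj R) e0; rewrite qjK qjZ e5 scalerN scalerA => /oppr_inj/eqP.
  rewrite -subr_eq0 -{1}[A 0%N]scale1r -scalerBl scaler_eq0 (negPf A0) orbF subr_eq0.
  by rewrite mulrC eq_sym => /eqP.
have tt : sqrtC c * (sqrtC c)^* = 1.
  have nc : `|c| = 1 by apply/eqP; rewrite -(@eqrXn2 _ 2) // normCK cc expr1n.
  by rewrite -normCK -normrX sqrtCK nc.
exists (sqrtC c).
  by apply/eqP => c0; move/eqP: tt; rewrite c0 mul0r eq_sym oner_eq0.
move=> k lt_k6; rewrite qjZ scalerA [_ * _^*]mulrC -scalerA qjA // scalerA.
congr (_ *: _).
by rewrite -[X in _ = _ * X]sqrtCK expr2 mulrA [_^* * _]mulrC tt mul1r.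
Qed.

End Antipodal.

Theorem theorem6p3 (R : realType) (psi : sphere R -> CP R 3)
    (hpsi : AHHolLF 5 psi) :
  exists (g : CP R 3 -> CP R 3) (omega : sphere R -> sphere R) (eta : R),
    [/\ PSp2 g, PSU2 omega, 0 <= eta & forall z, g (psi (omega z)) = Psi5 eta z].
Proof.
have [[[f [repf horf _]] full] anti] := hpsi.
have [t t0 rA] := antipodal_qreal repf full anti.
have [nz max_size psiE] := repf.
have szf i : (size (f i ord0) <= 6)%N by rewrite -max_size (leq_bigmax i).
have quinticZr x y : quintic (fun k => t *: coefs f k) x y = t *: quintic (coefs f) x y.
  by apply: entry_inj => i _; rewrite entryZ !entry_quintic !entryZ; ring.
have quinticxZr x y : quinticx (fun k => t *: coefs f k) x y = t *: quinticx (coefs f) x y.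
  by apply: entry_inj => i _; rewrite entryZ !entry_quinticx !entryZ; ring.
apply: (normal_form_of_qreal _ _ rA).
- move=> x y xy0; rewrite quinticZr scaler_eq0 negb_or t0 quintic_neq0 //.
  exact: top_coef_neq0.
- by move=> x y xy0; rewrite psiE poly_curve_hom_pt // quinticZr ptZ.
apply/horizontalP => z; rewrite quinticZr quinticxZr symplZl symplZr.
rewrite -eval_at_quintic // -eval_at_quinticx // horizontal_at_sympl ?mulr0 //.
exact: eval_at_neq0.
Qed.
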